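(* Let $\mathscr S$ be an operator system, let $\mathscr T$ be a unital $C^*$-algebra, and let $\mathcal K\subseteq\mathrm{CP}(\mathscr S,\mathscr T)$. If $0\in\overline{\mathrm{cconv}(\mathcal K)}^{\,\tau}$, then $$(\mathcal K^\circ)^{\circ_{C^*}}=\overline{\mathrm{cconv}(\mathcal K)}^{\,\tau}.$$
   Context: $\mathrm{CP}(\mathscr S,\mathscr T)$ is the set of all completely positive linear maps $\mathscr S\to\mathscr T$. For a linear map $\Phi:\mathscr S\to\mathscr T$ and $k\in\mathbb N$ ($k\ge1$), $\Phi_k:M_k(\mathscr S)\to M_k(\mathscr T)$ is the ampliation $\Phi_k([s_{ij}])=[\Phi(s_{ij})]$. A $C^*$-convex combination of $\Phi_1,\dots,\Phi_n\in \mathrm{CP}(\mathscr S,\mathscr T)$ is a map $\sum_{i=1}^n a_i^*\Phi_i(\cdot)a_i$ with $a_i\in\mathscr T$ and $\sum_{i=1}^n a_i^*a_i=\mathbb 1_{\mathscr T}$ ($n\ge 1$). A subset of $\mathrm{CP}(\mathscr S,\mathscr T)$ is $C^*$-convex if it is closed under all such finite combinations of its elements; $\mathrm{cconv}(\mathcal K)$ is the smallest $C^*$-convex subset of $\mathrm{CP}(\mathscr S,\mathscr T)$ containing $\mathcal K$. A matrix test is a triple $(k,f,s)$ with $k\in\mathbb N$, $f$ a state on $M_k(\mathscr T)$ (positive linear functional with $f(\mathbb 1)=1$), and $s\in M_k(\mathscr S)$. $\mathcal E=\mathrm{span}_{\mathbb C}(\mathrm{CP}(\mathscr S,\mathscr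 T))$, a complex vector space of linear maps $\mathscr S\to\mathscr T$. $\tau$ is the locally convex topology on $\mathcal E$ generated by the seminorms $p_{k,f,s}(\Phi)=|f(\Phi_k(s))|$ over all matrix tests $(k,f,s)$, and $\overline{\,\cdot\,}^{\,\tau}$ is $\tau$-closure in $\mathcal E$. The $C^*$-convex polar of $\mathcal K$ is the collection of matrix tests $$\mathcal K^\circ=\{(k,f,s)\ :\ \Re f(\Psi_k(s))\le 1\ \text{for all }\Psi\in\mathrm{cconv}(\mathcal K)\},$$ and for a collection $\mathcal C$ of matrix tests, $$\mathcal C^{\circ_{C^*}}=\{\Phi\in\mathrm{CP}(\mathscr S,\mathscr T)\ :\ \Re f(\Phi_k(s))\le 1\ \text{for all }(k,f,s)\in\mathcal C\}.$$ *)

(* Defs.v *)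
From HB Require Import structures.
From mathcomp Require Import all_boot all_order all_algebra.
From mathcomp Require Import complex.
From mathcomp Require Import all_classical all_reals all_analysis.

Set Implicit Arguments.
Unset Strict Implicit.
Unset Printing Implicit Defensive.

Import Order.TTheory GRing.Theory Num.Theory.
Import numFieldNormedType.Exports.

Local Open Scope complex_scope.
Local Open Scope classical_set_scope.
Local Open Scope ring_scope.

(* Unital C*-algebras over R[i], possibly zero.  The multiplication is part of
   the mixin, with the pzRingType structure derived from it below, because the
   hierarchy has no structure joining pzRingType and completeNormedModType.
   The norm takes its values in (the nonnegative reals of) R[i]. *)
HB.mixin Record isCStarAlgebra (R : realType) T
    of CompleteNormedModule R[i] T := {
  cstar_one : T;
  cstar_mul : T -> T -> T;
  cstar : T -> T;
  cstar_mulA : associative cstar_mul;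
  cstar_mul1l : left_id cstar_one cstar_mul;
  cstar_mul1r : right_id cstar_one cstar_mul;
  cstar_mulDl : left_distributive cstar_mul +%R;
  cstar_mulDr : right_distributive cstar_mul +%R;
  cstar_scaleAl : forall (a : R[i]) (x y : T),
    a *: cstar_mul x y = cstar_mul (a *: x) y;
  cstar_scaleAr : forall (a : R[i]) (x y : T),
    a *: cstar_mul x y = cstar_mul x (a *: y);
  cstarK : involutive cstar;
  cstarD : {morph cstar : x y / x + y};
  cstarZ : forall (a : R[i]) (x : T), cstar (a *: x) = a^* *: cstar x;
  cstarM : forall x y : T, cstar (cstar_mul x y) = cstar_mul (cstar y) (cstar x);
  cstar_ler_normM : forall x y : T, `|cstar_mul x y| <= `|x| * `|y|;
  cstar_normE : forall x : T, `|cstar_mul (cstar x) x| = `|x| ^+ 2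
}.

#[short(type="cstarAlgType")]
HB.structure Definition CStarAlgebra (R : realType) :=
  {T of CompleteNormedModule R[i] T & isCStarAlgebra R T}.

HB.instance Definition _ (R : realType) (T : cstarAlgType R) :=
  GRing.Zmodule_isPzRing.Build (CStarAlgebra.sort T)
    (@cstar_mulA R T) (@cstar_mul1l R T) (@cstar_mul1r R T)
    (@cstar_mulDl R T) (@cstar_mulDr R T).

(* The matrix [star (X j i)]_(i, j). *)
Definition mxstar (V : Type) (star : V -> V) (n : nat) (X : 'M[V]_n) : 'M[V]_n :=
  (map_mx star X)^T.

(* The product A^* X A of a matrix X over a vector space with a rectangular
   scalar matrix A. *)
Definition mxcompress (R : realType) (V : lmodType R[i]) (n m : nat)
    (A : 'M[R[i]]_(n, m)) (X : 'M[V]_n) : 'M[V]_m :=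
  \matrix_(i, j) \sum_k \sum_l ((A k i)^* * A l j) *: X k l.

(* Abstract (Choi-Effros) operator systems: a complex *-vector space with a
   proper matrix ordering and an Archimedean matrix order unit. *)
HB.mixin Record isOpSystem (R : realType) S of GRing.Lmodule R[i] S := {
  opstar : S -> S;
  opunit : S;
  oppos : forall n : nat, set 'M[S]_n;
  opstarK : involutive opstar;
  opstarD : {morph opstar : x y / x + y};
  opstarZ : forall (a : R[i]) (x : S), opstar (a *: x) = a^* *: opstar x;
  opunit_star : opstar opunit = opunit;
  oppos_star : forall (n : nat) (X : 'M[S]_n), oppos n X -> mxstar opstar X = X;
  oppos0 : forall n : nat, oppos n 0;
  opposD : forall (n : nat) (X Y : 'M[S]_n),
    oppos n X -> oppos n Y -> oppos n (X + Y);
  oppos_compress : forall (n m : nat) (A : 'M[R[i]]_(n, m)) (X : 'M[S]_n),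
    oppos n X -> oppos m (mxcompress A X);
  oppos_proper : forall (n : nat) (X : 'M[S]_n),
    oppos n X -> oppos n (- X) -> X = 0;
  opunit_order : forall (n : nat) (X : 'M[S]_n), mxstar opstar X = X ->
    exists2 r : R, 0 < r & oppos n ((r%:C *: opunit)%:M + X);
  opunit_archi : forall (n : nat) (X : 'M[S]_n), mxstar opstar X = X ->
    (forall r : R, 0 < r -> oppos n ((r%:C *: opunit)%:M + X)) -> oppos n X
}.

#[short(type="opSystemType")]
HB.structure Definition OpSystem (R : realType) :=
  {S of GRing.Lmodule R[i] S & isOpSystem R S}.

Arguments oppos {R s} n.

(* The positive elements Y^* Y of the C*-algebra M_n(T). *)
Definition cpos (R : realType) (T : cstarAlgType R) (n : nat) : set 'M[T]_n :=
  [set X | exists Y : 'M[T]_n, X = mxstar cstar Y *m Y].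

Definition CP (R : realType) (S : opSystemType R) (T : cstarAlgType R) :
    set (S -> T) :=
  [set Phi | linear Phi /\
    forall (n : nat) (X : 'M[S]_n), oppos n X -> cpos (map_mx Phi X)].

Arguments CP {R} S T.

Definition cstar_convex (R : realType) (S : opSystemType R)
    (T : cstarAlgType R) (A : set (S -> T)) : Prop :=
  forall (n : nat) (Phi : 'I_n.+1 -> S -> T) (a : 'I_n.+1 -> T),
    (forall i, A (Phi i)) -> \sum_i cstar (a i) * a i = 1 ->
    A (fun s => \sum_i cstar (a i) * Phi i s * a i).

Definition cconv (R : realType) (S : opSystemType R) (T : cstarAlgType R)
    (K : set (S -> T)) : set (S -> T) :=
  smallest [set A | A `<=` CP S T /\ cstar_convex A] K.

(* Linearity is spelled out because 'M[T]_k has no canonical R[i]-module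
   structure; [map_mx ( *:%R a) X] is the scalar multiple of X by a. *)
Definition mxstate (R : realType) (T : cstarAlgType R) (k : nat)
    (f : 'M[T]_k -> R[i]) : Prop :=
  [/\ forall (a : R[i]) (X Y : 'M[T]_k),
        f (map_mx ( *:%R a) X + Y) = a * f X + f Y,
      forall X : 'M[T]_k, cpos X -> 0 <= f X
    & f 1%:M = 1].

Record matrix_test (R : realType) (S : opSystemType R) (T : cstarAlgType R) :=
  MatrixTest {
    mt_size : nat;
    mt_fun : 'M[T]_mt_size -> R[i];
    mt_mx : 'M[S]_mt_size;
    mt_size_gt0 : (0 < mt_size)%N;
    mt_funP : mxstate mt_fun
  }.

Arguments mt_fun {R S T} m _.

(* f (Phi_k (s)) for the test t = (k, f, s). *)
Definition mt_eval (R : realType) (S : opSystemType R) (T : cstarAlgType R)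
    (t : matrix_test S T) (Phi : S -> T) : R[i] :=
  mt_fun t (map_mx Phi (mt_mx t)).

Section CPSpan.
Variables (R : realType) (S : opSystemType R) (T : cstarAlgType R).

Definition cp_span : set (S -> T) :=
  [set Phi | exists (n : nat) (c : 'I_n -> R[i]) (Psi : 'I_n -> S -> T),
    (forall i, CP S T (Psi i)) /\ Phi = \sum_i c i *: Psi i].

Definition cp_span_pred : {pred S -> T} := fun Phi => `[< cp_span Phi >].

Lemma cp_span_submod : submod_closed cp_span_pred.
Proof.
split; first by apply/asboolP; exists 0%N, (fun=> 0), (fun=> 0); split;
  [case|rewrite big_ord0].
move=> a _ _ /asboolP[n [c [P [hP ->]]]] /asboolP[m [d [Q [hQ ->]]]].
apply/asboolP; exists (n + m)%N.
exists (fun i : 'I_(n + m) => match fintype.split i with inl j => a * c j | inr j => d j end).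
exists (fun i : 'I_(n + m) => match fintype.split i with inl j => P j | inr j => Q j end).
split=> [i|]; first by case: (fintype.split i).
rewrite big_split_ord scaler_sumr /=; congr (_ + _); apply: eq_bigr => i _.
  by rewrite (unsplitK (inl i)) scalerA.
by rewrite (unsplitK (inr i)).
Qed.

HB.instance Definition _ := GRing.isSubmodClosed.Build R[i] (S -> T)
  cp_span_pred cp_span_submod.

(* The complex vector space spanned by the completely positive maps, with the
   topology generated by the seminorms Phi |-> |f (Phi_k (s))|. *)
Definition cp_space : Type := {Phi : S -> T | Phi \in cp_span_pred}.

HB.instance Definition _ := SubChoice.on cp_space.
HB.instance Definition _ := [SubChoice_isSubLmodule of cp_space by <:].

Definition tau_seminorm (t : matrix_test S T) (Phi : cp_space) : R[i] :=
  `|mt_eval t (val Phi)|.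

Definition tau_subbase : set (set cp_space) :=
  [set U | exists (t : matrix_test S T) (Phi0 : cp_space) (e : R), 0 < e /\
    U = [set Phi | tau_seminorm t (Phi - Phi0) < e%:C]].

HB.instance Definition _ :=
  isSubBaseTopological.Build cp_space tau_subbase id.

(* The closure of A in the space above, as a set of maps S -> T. *)
Definition tau_closure (A : set (S -> T)) : set (S -> T) :=
  val @` closure (val @^-1` A : set cp_space).

End CPSpan.

Definition polar (R : realType) (S : opSystemType R) (T : cstarAlgType R)
    (K : set (S -> T)) : set (matrix_test S T) :=
  [set t | forall Psi, cconv K Psi -> complex.Re (mt_eval t Psi) <= 1].

Definition cstar_polar (R : realType) (S : opSystemType R)
    (T : cstarAlgType R) (C : set (matrix_test S T)) : set (S -> T) :=
  [set Phi | CP S T Phi /\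
    forall t, C t -> complex.Re (mt_eval t Phi) <= 1].

(* Main.v *)
(* [cstar_polar (polar K)] contains the closure of the C*-convex hull since
   completely positive maps form a tau-closed C*-convex set, and conversely a
   completely positive Phi outside the closure can be separated from the hull by
   one matrix test: finitely many tests witness the separation, the functional
   produced by Hahn-Banach on C^m is absorbed in the matrix entries, and the
   states are averaged into one state on the diagonal blocks of a larger matrix
   algebra.

   The first inclusion needs that an element of M_n(T) on which all states are
   nonnegative is of the form Y^* Y.  In T itself, the cone of squares of
   self-adjoint elements is closed and, by Kaplansky's argument, contains all
   x^* x; Hahn-Banach then provides the states.  M_n(T) is not renormed: X is
   compared with the T-valued inner product on T^n, and a matrix X which is
   positive in this sense is a square by the same square root iteration, run
   entrywise in T. *)

(* The topology sees a map only through states, whereas [CP] asks for an actual factorization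
   [Y^* Y]. Passing to a limit therefore means manufacturing a square root from scalar inequalities,
   and this takes up most of the development. Both square roots, in [T] and in matrices, come from
   one iteration majorized by a real sequence. Hahn-Banach is likewise used twice in one real form
   (Mazur-Orlicz): a sublinear functional that is at least [e] on a convex set dominates a
   real-linear one with the same lower bound there. A single point yields a state; differences of
   evaluation vectors yield the separating functional, with a quantitative gap. The gap is where the
   hypothesis on 0 enters. A separating test comes with some threshold, polars know only the
   threshold 1, and rescaling needs the threshold to be positive. Since 0 is a limit of the hull,
   the value at the separated map is at least the gap, which leaves room for a positive threshold
   strictly below that value. *)
Require Import Defs.
From HB Require Import structures.
From mathcomp Require Import all_boot all_order all_algebra.
From mathcomp Require Import complex.
From mathcomp Require Import all_classical all_reals all_analysis.
From mathcomp Require Import ring lra.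

Set Implicit Arguments.
Unset Strict Implicit.
Unset Printing Implicit Defensive.

Import Order.TTheory GRing.Theory Num.Theory.
Import numFieldNormedType.Exports.

Local Open Scope complex_scope.
Local Open Scope classical_set_scope.
Local Open Scope ring_scope.

(* The square-zero extension of K by V: it embeds a K-module into a commutative
   ring, where the [ring] tactic decides linear identities. *)
Definition sqz (K : comNzRingType) (V : lmodType K) : Type := (K * V)%type.

Section SquareZero.
Variables (K : comNzRingType) (V : lmodType K).
Local Notation A := (sqz V).

HB.instance Definition _ := GRing.Zmodule.copy A (K * V)%type.

Definition sqz_mul (x y : A) : A := (x.1 * y.1, x.1 *: y.2 + y.1 *: x.2).

Lemma sqz_mulA : associative sqz_mul.
Proof.
move=> [a x] [b y] [c z]; rewrite /sqz_mul /= mulrA; congr (_, _).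
by rewrite !scalerDr !scalerA addrA (mulrC c a) (mulrC c b).
Qed.

Lemma sqz_mulC : commutative sqz_mul.
Proof. by move=> [a x] [b y]; rewrite /sqz_mul /= mulrC addrC. Qed.

Lemma sqz_mul1 : left_id ((1, 0) : A) sqz_mul.
Proof. by move=> [a x]; rewrite /sqz_mul /= mul1r scale1r scaler0 addr0. Qed.

Lemma sqz_mulDl : left_distributive sqz_mul +%R.
Proof.
move=> [a x] [b y] [c z]; rewrite /sqz_mul /= mulrDl; congr (_, _).
by rewrite scalerDl scalerDr addrACA.
Qed.

Lemma sqz_oner_neq0 : ((1, 0) : A) != 0.
Proof. by apply/eqP => -[/eqP]; rewrite oner_eq0. Qed.

HB.instance Definition _ := GRing.Zmodule_isComNzRing.Build A
  sqz_mulA sqz_mulC sqz_mul1 sqz_mulDl sqz_oner_neq0.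

Definition sqz_in (x : V) : A := (0, x).
Definition sqz_sc (a : K) : A := (a, 0).

Lemma sqz_in_is_additive : additive sqz_in.
Proof. by move=> x y; congr (_, _); rewrite ?subrr. Qed.

HB.instance Definition _ := GRing.isAdditive.Build V A sqz_in sqz_in_is_additive.

Lemma sqz_inI : injective sqz_in.
Proof. by move=> x y []. Qed.

Lemma sqz_sc_is_additive : additive sqz_sc.
Proof. by move=> x y; congr (_, _); rewrite ?subrr. Qed.

HB.instance Definition _ := GRing.isAdditive.Build K A sqz_sc sqz_sc_is_additive.

Lemma sqz_sc_is_multiplicative : multiplicative sqz_sc.
Proof. by split=> // x y; congr (_, _); rewrite /= !scaler0 addr0. Qed.

HB.instance Definition _ :=
  GRing.isMultiplicative.Build K A sqz_sc sqz_sc_is_multiplicative.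

Lemma sqz_inZ a x : sqz_in (a *: x) = sqz_sc a * sqz_in x.
Proof. by congr (_, _); rewrite ?mulr0 //= scale0r addr0. Qed.

Lemma sqz_inD x y : sqz_in (x + y) = sqz_in x + sqz_in y.
Proof. exact: raddfD. Qed.

Lemma sqz_inN x : sqz_in (- x) = - sqz_in x.
Proof. exact: raddfN. Qed.

End SquareZero.

Ltac zmod_eq :=
  match goal with |- @eq ?V _ _ => apply: (@sqz_inI _ (zmodule V)); ring end.

Ltac lmod_eq := match goal with |- @eq ?V _ _ => apply: (@sqz_inI _ V);
  rewrite ?(sqz_inD, sqz_inN, sqz_inZ); ring end.

(** * Real Hahn-Banach and Mazur-Orlicz theorems for sublinear functionals *)

Section HahnBanach.
Variables (R : realType) (V : lmodType R[i]).
Implicit Types (p q g : V -> R) (x y : V) (D : set V).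

Definition sublinear p :=
  (forall x y, p (x + y) <= p x + p y) /\
  (forall (r : R) x, 0 <= r -> p (r%:C *: x) = r * p x).

Definition real_linear g :=
  (forall x y, g (x + y) = g x + g y) /\ (forall (r : R) x, g (r%:C *: x) = r * g x).

Definition real_convex D := forall (r s : R) x y,
  0 <= r -> 0 <= s -> r + s = 1 -> D x -> D y -> D (r%:C *: x + s%:C *: y).

Lemma le_inf_imset (I : Type) (A : set I) (F : I -> R) (c : R) :
  A !=set0 -> (forall i, A i -> c <= F i) -> c <= inf (F @` A).
Proof.
move=> [i Ai] h; apply: lb_le_inf; first by exists (F i); exists i.
by move=> _ [j Aj <-]; exact: h.
Qed.

Lemma inf_imset_le (I : Type) (A : set I) (F : I -> R) (c : R) i :
  (forall i, A i -> c <= F i) -> A i -> inf (F @` A) <= F i.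
Proof.
move=> h Ai; apply: ge_inf; last by exists i.
by exists c => _ [j Aj <-]; exact: h.
Qed.

Lemma sublinear0 p : sublinear p -> p 0 = 0.
Proof. by case=> _ /(_ 0 0 (lexx _)); rewrite scaler0 mul0r. Qed.

Lemma sublinear_ge p x : sublinear p -> - p (- x) <= p x.
Proof.
move=> hp; have := hp.1 x (- x); rewrite subrr (sublinear0 hp); lra.
Qed.

Lemma sublinearP q : q 0 = 0 -> (forall x y, q (x + y) <= q x + q y) ->
  (forall (r : R) x, 0 < r -> q (r%:C *: x) <= r * q x) -> sublinear q.
Proof.
move=> q0 qD qZ; split=> // r x; rewrite le_eqVlt => /orP[/eqP<-|r0].
  by rewrite scale0r mul0r.
apply/le_anti; rewrite qZ //= -ler_pdivlMl //.
have := qZ r^-1 (r%:C *: x); rewrite invr_gt0 => /(_ r0).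
by rewrite scalerA -rmorphM /= mulVf ?gt_eqF // scale1r.
Qed.

(** The lower bound wanted on [D] is turned into upper bounds at the points [- d], so that any
    linear functional below [q] inherits it. The functional [q x] is the infimum of
    [p (x + t d) - t e] over [t >= 0] and [d] in [D]; it is finite because [p (t d) >= t e]. *)
Lemma sublinear_minorant p D (e : R) : sublinear p -> D !=set0 ->
  real_convex D -> (forall d, D d -> e <= p d) ->
  exists q, [/\ sublinear q, forall x, q x <= p x & forall d, D d -> q (- d) <= - e].
Proof.
move=> hp [d0 Dd0] cD De.
pose A := [set td : R * V | 0 <= td.1 /\ D td.2].
pose F x (td : R * V) := p (x + td.1%:C *: td.2) - td.1 * e.
pose q x := inf (F x @` A).
have A0 : A !=set0 by exists (0, d0); split=> /=.
have Flb x td : A td -> - p (- x) <= F x td.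
  case: td => t d [/= t0 Dd]; rewrite /F /=.
  have := hp.1 (x + t%:C *: d) (- x); rewrite addrC addKr hp.2 //.
  have := ler_wpM2l t0 (De _ Dd); lra.
have qle x td : A td -> q x <= F x td by apply: inf_imset_le; exact: Flb.
have leq x c : (forall td, A td -> c <= F x td) -> c <= q x by exact: le_inf_imset.
have q0 : q 0 = 0.
  apply/le_anti/andP; split.
    have /(qle 0) : A (0, d0) by split=> /=.
    by rewrite /F /= scale0r addr0 (sublinear0 hp) mul0r subr0.
  by apply: leq => td /(Flb 0); rewrite oppr0 (sublinear0 hp) oppr0.
have qD x y : q (x + y) <= q x + q y.
  rewrite -lerBlDr; apply: (leq) => -[t d] [/= t0 Dd].
  rewrite lerBlDr -lerBlDl; apply: leq => -[s c] [/= s0 Dc].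
  rewrite lerBlDl /F /=.
  have [ts0|ts0] := eqVneq (t + s) 0.
    have t00 : t = 0 by lra.
    have s00 : s = 0 by lra.
    have /(qle (x + y)) : A (0, d0) by split=> /=.
    move/le_trans; apply; rewrite /F /= t00 s00 !scale0r !addr0.
    by have := hp.1 x y; lra.
  (* Convexity of [D] enters here: [t d + s c] is [t + s] times the point [b] of [D]. *)
  have ts : 0 < t + s by lra.
  pose b := (t / (t + s))%:C *: d + (s / (t + s))%:C *: c.
  have Ab : A (t + s, b).
    split=> /=; first exact: ltW.
    by apply: cD; rewrite ?divr_ge0 ?(ltW ts) // -mulrDl mulfV.
  have := qle (x + y) _ Ab; move/le_trans; apply.
  rewrite /F /= scalerDr !scalerA -!rmorphM /= !(mulrC (t + s)) !divfK //.
  have := hp.1 (x + t%:C *: d) (y + s%:C *: c); rewrite addrACA; lra.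
have qZ (r : R) x : 0 < r -> q (r%:C *: x) <= r * q x.
  move=> r0; rewrite -ler_pdivrMl //; apply: (leq) => -[t d] [/= t0 Dd].
  rewrite ler_pdivrMl //.
  have : A (r * t, d) by split=> //=; rewrite mulr_ge0 // ltW.
  move=> /(qle (r%:C *: x)) /le_trans; apply.
  by rewrite /F /= mulrBr -hp.2 ?(ltW r0) // scalerDr scalerA -rmorphM mulrA.
exists q; split; first exact: sublinearP.
  move=> x; have /(qle x) : A (0, d0) by split=> /=.
  by rewrite /F /= scale0r addr0 mul0r subr0.
move=> d Dd; have /(qle (- d)) : A (1, d) by split=> //=; exact: ler01.
by rewrite /F /= scale1r addNr (sublinear0 hp) mul1r sub0r.
Qed.

(* Applying [sublinear_minorant] to the singletons shows that the minimal
   sublinear functionals are the linear ones. *)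
Lemma minimal_sublinear_linear q : sublinear q ->
  (forall q', sublinear q' -> (forall x, q' x <= q x) -> q' = q) ->
  real_linear q.
Proof.
move=> hq qmin.
have qN x : q (- x) = - q x.
  have c1 : real_convex [set x].
    by move=> r s _ _ _ _ rs -> ->; rewrite /= -scalerDl -rmorphD rs scale1r.
  have [|//|q' [hq' q'q q'x]] := sublinear_minorant hq _ c1 (e := q x).
  - by exists x.
  - by move=> d ->.
  apply/le_anti; rewrite -{1}(qmin _ hq' q'q) q'x //=.
  by have := sublinear_ge (- x) hq; rewrite opprK.
split=> [x y|r x].
  apply/le_anti; rewrite hq.1 /=.
  by have := hq.1 (- x) (- y); rewrite -opprD !qN; lra.
have [r0|r0] := leP 0 r; first exact: hq.2.
have := hq.2 (- r) x; rewrite oppr_ge0 => /(_ (ltW r0)).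
by rewrite rmorphN scaleNr qN mulNr => /oppr_inj.
Qed.

(** Zorn is applied to the sublinear functionals below [p], with the pointwise order reversed so
    that maximal elements are minimal functionals. The pointwise infimum of a chain stays
    subadditive because, of any two members, the smaller one serves for both arguments. *)
Lemma hahn_banach p : sublinear p ->
  exists2 g, real_linear g & forall x, g x <= p x.
Proof.
move=> hp.
pose T := {q : V -> R | sublinear q /\ forall x, q x <= p x}.
pose ge (s t : T) := `[< forall x, sval t x <= sval s x >].
have [| | | |t tmin] := @Zorn T ge.
- by move=> t; apply/asboolP.
- move=> r s t /asboolP rs /asboolP st; apply/asboolP => x.
  exact: le_trans (st x) (rs x).
- move=> [s hs] [t ht] /asboolP /= st /asboolP /= ts; apply: eq_exist.
  by apply/funext => x; apply/le_anti; rewrite st ts.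
- move=> A totA; have [->|/set0P A0] := eqVneq A set0.
    by exists (exist _ p (conj hp (fun x => lexx (p x)))).
  pose F x (s : T) := sval s x.
  have Flb x s : A s -> - p (- x) <= F x s.
    case: s => s [hs sp] _; rewrite /F /=; apply: le_trans (sublinear_ge _ hs).
    by rewrite lerN2.
  pose q x := inf (F x @` A).
  have qle x s : A s -> q x <= F x s by apply: inf_imset_le; exact: Flb.
  have leq x c : (forall s, A s -> c <= F x s) -> c <= q x by exact: le_inf_imset.
  have [a Aa] := A0.
  have hq : sublinear q.
    apply: sublinearP.
    - apply/le_anti/andP; split.
        by have := qle 0 a Aa; rewrite /F (sublinear0 (svalP a).1).
      by apply: leq => s _; rewrite /F (sublinear0 (svalP s).1).
    - move=> x y; rewrite -lerBlDr; apply: (leq) => s As.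
      rewrite lerBlDr -lerBlDl; apply: leq => t At; rewrite lerBlDl.
      have [/asboolP st|/asboolP ts] := totA _ _ As At.
        apply: le_trans (qle _ _ At) _; apply: le_trans ((svalP t).1.1 _ _) _.
        by apply: lerD => //; exact: st.
      apply: le_trans (qle _ _ As) _; apply: le_trans ((svalP s).1.1 _ _) _.
      by apply: lerD => //; exact: ts.
    - move=> r x r0; rewrite -ler_pdivrMl //; apply: (leq) => s As.
      rewrite ler_pdivrMl //; apply: le_trans (qle _ _ As) _.
      by rewrite /F (svalP s).1.2 // ltW.
  have qp x : q x <= p x by apply: le_trans (qle _ _ Aa) ((svalP a).2 x).
  exists (exist _ q (conj hq qp)) => s As; apply/asboolP => x /=; exact: qle.
exists (sval t); last exact: (svalP t).2.
apply: minimal_sublinear_linear; first exact: (svalP t).1.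
move=> q hq qt.
have hqp x : q x <= p x by apply: le_trans (qt x) ((svalP t).2 x).
rewrite -(tmin (exist _ q (conj hq hqp))) //.
by apply/asboolP => x /=; exact: qt.
Qed.

Lemma mazur_orlicz p D (e : R) : sublinear p -> D !=set0 ->
  real_convex D -> (forall d, D d -> e <= p d) ->
  exists g, [/\ real_linear g, forall x, g x <= p x & forall d, D d -> e <= g d].
Proof.
move=> hp D0 cD De; have [q [hq qp qD]] := sublinear_minorant hp D0 cD De.
have [g hg gq] := hahn_banach hq; exists g; split=> // [x|d Dd].
  exact: le_trans (gq x) (qp x).
have := le_trans (gq (- d)) (qD _ Dd).
have -> : - d = (-1)%:C *: d by rewrite rmorphN scaleN1r.
by rewrite hg.2; lra.
Qed.

End HahnBanach.

Lemma ltc0P (R : realType) (e : R[i]) : 0 < e -> exists2 r : R, 0 < r & e = r%:C.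
Proof.
case: e => a b; rewrite ltcE /= => /andP[/eqP -> a0].
by exists a.
Qed.

(** * Square roots by a majorized fixed-point iteration *)

Section SquareRootIteration.
Variable R : realType.

(** The case [z = 1] of [sqrt_iter] over the reals. It increases to 1 and serves as a majorant for
    the iteration with any [z] of norm at most 1. *)
Fixpoint half_sqr_iter (k : nat) : R :=
  if k is k'.+1 then (1 + half_sqr_iter k' ^+ 2) / 2 else 0.

Local Notation r := half_sqr_iter.

Lemma half_sqr_iter_ge0 k : 0 <= r k.
Proof. by case: k => [|k] //=; rewrite divr_ge0 // addr_ge0 // sqr_ge0. Qed.

Lemma half_sqr_iter_le1 k : r k <= 1.
Proof.
elim: k => [|k IH] /=; first exact: ler01.
by have := half_sqr_iter_ge0 k; nra.
Qed.

Lemma half_sqr_iter_homo : {homo r : k l / (k <= l)%N >-> k <= l}.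
Proof.
apply: homo_leq => [//|s t u|k]; [exact: le_trans|rewrite /=].
have := sqr_ge0 (1 - r k); rewrite !expr2; lra.
Qed.

Lemma half_sqr_iter_cvg1 k (e : R) : 0 < e -> exists2 l, (k <= l)%N & 1 - r l < e.
Proof.
move=> e0; suff [l hl] : exists l, 1 - r l < e.
  exists (maxn k l); first exact: leq_maxl.
  by apply: le_lt_trans hl; rewrite lerB // half_sqr_iter_homo // leq_maxr.
move: k => _.

(* The limit 1 is a double root of [x = (1 + x^2) / 2], so convergence is only of order [1/m]: the
   error [d] becomes [d - d^2 / 2]. *)
have h m : (1 - r m) * (m%:R + 1) <= 2.
  elim: m => [|k IH]; first by rewrite /=; lra.
  rewrite /= -[k.+1%:R]natr1.
  have := half_sqr_iter_ge0 k; have := half_sqr_iter_le1 k.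
  have : 0 <= k%:R :> R by [].
  set d := r k in IH *; set m : R := k%:R in IH *.
  move=> m0 d1 d0; rewrite expr2.
  have : 0 <= (1 + d) * (2 - (1 - d) * (m + 1)) by apply: mulr_ge0; lra.
  have := sqr_ge0 (1 - d); rewrite expr2; nra.
exists (Num.truncn (2 / e)).
have := truncnS_gt (2 / e); rewrite -natr1.
set k := Num.truncn _; rewrite ltr_pdivrMr // => ke.
have k0 : 0 <= k%:R :> R by [].
have := h k; have := half_sqr_iter_le1 k; nra.
Qed.

(* [N x r] stands for the norm bound "|x| <= r"; only closure properties of this
   relation are assumed, because it is used with the norm of a C*-algebra and
   with the order bounds of its matrix algebras. *)
Variables (B : pzRingType) (half : B -> B) (N : B -> R -> Prop) (z : B).
Hypothesis halfB : forall x y, half (x - y) = half x - half y.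
Hypothesis half_double : forall x, half x + half x = x.
Hypothesis N0 : N 0 0.
Hypothesis NN : forall x r, N x r -> N (- x) r.
Hypothesis ND : forall x y r s, N x r -> N y s -> N (x + y) (r + s).
Hypothesis NM : forall x y r s, N x r -> N y s -> N (x * y) (r * s).
Hypothesis Nhalf : forall x r, N x r -> N (half x) (r / 2).
Hypothesis Nle : forall x r s, N x r -> r <= s -> N x s.
Hypothesis N_eq0 : forall x, (forall e, 0 < e -> N x e) -> x = 0.
Hypothesis N_complete : forall (u : nat -> B) (d : nat -> R),
  (forall k l, (k <= l)%N -> N (u l - u k) (d k)) ->
  (forall k e, 0 < e -> exists2 l, (k <= l)%N & d l < e) ->
  exists y, forall k e, 0 < e -> N (y - u k) (d k + e).
Hypothesis Nz : N z 1.

(** A fixed point [y] satisfies [2 y = z + y^2], that is [(1 - y)^2 = 1 - z]. *)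
Fixpoint sqrt_iter (k : nat) : B :=
  if k is k'.+1 then half (z + sqrt_iter k' * sqrt_iter k') else 0.

Local Notation u := sqrt_iter.

Lemma sqrt_iter_bound k : N (u k) (r k).
Proof.
elim: k => [//|k IH] /=; apply: Nhalf; apply: ND => //.
by rewrite expr2; exact: NM.
Qed.

Lemma subr_mulr (A : pzRingType) (x y : A) :
  x * x - y * y = x * (x - y) + (x - y) * y.
Proof. by rewrite mulrBr mulrBl addrA subrK. Qed.

(** The splitting in [subr_mulr] needs no commutation, and the real sequence obeys the same
    recursion for its increments, so the majorization passes from one increment to the next. *)
Lemma sqrt_iterS_bound k : N (u k.+1 - u k) (r k.+1 - r k).
Proof.
elim: k => [|k IH].
  have := sqrt_iter_bound 1.
  by rewrite [u 0]/= [r 0]/= !subr0.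
have -> : u k.+2 - u k.+1 =
    half (u k.+1 * (u k.+1 - u k) + (u k.+1 - u k) * u k).
  by rewrite -subr_mulr [in LHS]/= -halfB opprD addrACA subrr add0r.
have -> : r k.+2 - r k.+1 =
    (r k.+1 * (r k.+1 - r k) + (r k.+1 - r k) * r k) / 2.
  have : r k.+1 = (1 + r k ^+ 2) / 2 by [].
  have -> : r k.+2 = (1 + r k.+1 ^+ 2) / 2 by [].
  by move: (r k.+1) (r k) => a b; rewrite !expr2; nra.
by apply/Nhalf/ND; apply: NM => //; exact: sqrt_iter_bound.
Qed.

Lemma sqrt_iter_cauchy k l : (k <= l)%N -> N (u l - u k) (1 - r k).
Proof.
move=> kl; suff h : N (u l - u k) (r l - r k).
  by apply: Nle h _; rewrite lerD2r half_sqr_iter_le1.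
rewrite -(subnK kl) addnC; elim: (l - k)%N => [|m IH].
  by rewrite addn0 !subrr.
rewrite addnS -(subrK (u (k + m)) (u _.+1)) -(subrK (r (k + m)) (r _.+1)).
rewrite -[X in N X _]addrA -[X in N _ X]addrA; apply: ND => //; exact: sqrt_iterS_bound.
Qed.

(** The last clause makes approximable by elements of [C] whatever is reached from 0 by the
    iteration; it is how self-adjointness and commutation relations pass to [y]. *)
Lemma sqrt_iteration : exists y,
  [/\ (1 - y) * (1 - y) = 1 - z, forall e, 0 < e -> N y (1 + e) &
    forall C : B -> Prop, C 0 -> (forall v, C v -> C (half (z + v * v))) ->
      forall e, 0 < e -> exists2 v, C v & N (y - v) e].
Proof.
have [y hy] := N_complete sqrt_iter_cauchy half_sqr_iter_cvg1.
have Ny e : 0 < e -> N y (1 + e).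
  by move=> e0; have := hy 0 _ e0; rewrite [u 0]/= [r 0]/= !subr0.
(* Two consecutive iterates must be close to [y] at once, because the recursion relates [u k.+1] to
   [u k]. *)
have close e : 0 < e -> exists2 k, N (y - u k) e & N (y - u k.+1) e.
  move=> e0; have e20 : 0 < e / 2 by lra.
  have [k _ hk] := half_sqr_iter_cvg1 0 e20; exists k.
    by apply: Nle (hy k _ e20) _; lra.
  apply: Nle (hy k.+1 _ e20) _.
  by have := half_sqr_iter_homo (leqnSn k); lra.
exists y; split=> //.
  suff h : (y * y + z) - (y + y) = 0.
    apply/eqP; rewrite -subr_eq0 -h; apply/eqP.
    by rewrite mulrBl mul1r mulrBr mulr1; zmod_eq.
  apply: N_eq0 => e e0.
  (* The errors below add up to at most [5 d], as [y] is bounded by 2 and [u k] by 1; hence a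
     fraction such as [e / 8]. *)
  have e80 : 0 < Num.min 1 (e / 8) by rewrite lt_min ltr01; lra.
  have [k hk hk1] := close _ e80.
  have -> : y * y + z - (y + y) = (y * (y - u k) + (y - u k) * u k) -
      ((y - u k.+1) + (y - u k.+1)).
    have := half_double (z + u k * u k); rewrite -[half _]/(u k.+1) => hk2.
    rewrite -subr_mulr; apply/eqP; rewrite -subr_eq0; apply/eqP.
    rewrite -[RHS](subrr (z + u k * u k)) -{2}hk2; zmod_eq.
  set d := Num.min _ _ in e80 hk hk1.
  have d1 : d <= 1 by rewrite ge_min lexx.
  have de : d <= e / 8 by rewrite ge_min lexx orbT.
  have h := ND (ND (NM (Ny _ ltr01) hk) (NM hk (sqrt_iter_bound k)))
    (NN (ND hk1 hk1)).
  apply: Nle h _.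
  by have := half_sqr_iter_le1 k; have := half_sqr_iter_ge0 k; nra.
move=> C C0 CS e e0; have [k hk _] := close _ e0; exists (u k) => //.
by elim: k {hk} => [//|k IH] /=; exact: CS.
Qed.

End SquareRootIteration.

(** * The real-valued norm of a C*-algebra *)

Section CStarNorm.
Variables (R : realType) (T : cstarAlgType R).
Implicit Types (x y : T) (r s : R).

Definition nrm x : R := complex.Re `|x|.

Lemma nrmE x : `|x| = (nrm x)%:C.
Proof.
by rewrite [LHS]complexE (ger0_Im (normr_ge0 x)) rmorph0 mulr0 addr0.
Qed.

Lemma nrm_ge0 x : 0 <= nrm x.
Proof. by rewrite -ler0c -nrmE. Qed.

Lemma nrmD x y : nrm (x + y) <= nrm x + nrm y.
Proof. by rewrite -lecR rmorphD /= -!nrmE ler_normD. Qed.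

Lemma nrmN x : nrm (- x) = nrm x.
Proof. by rewrite /nrm normrN. Qed.

Lemma nrmM x y : nrm (x * y) <= nrm x * nrm y.
Proof. by rewrite -lecR rmorphM /= -!nrmE; exact: cstar_ler_normM. Qed.

Lemma nrm_eq0 x : nrm x <= 0 -> x = 0.
Proof. by rewrite -lecR -nrmE normr_le0 => /eqP. Qed.

Lemma nrm0 : nrm 0 = 0.
Proof. by rewrite /nrm normr0. Qed.

Lemma nrmZ (a : R[i]) x : nrm (a *: x) = complex.Re `|a| * nrm x.
Proof. by rewrite /nrm normrZ !nrmE (normc_def a) -rmorphM. Qed.

Lemma nrmZr r x : nrm (r%:C *: x) = `|r| * nrm x.
Proof. by rewrite nrmZ normc_def /= expr0n addr0 sqrtr_sqr. Qed.

Lemma nrm_sqr x : nrm (cstar x * x) = nrm x ^+ 2.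
Proof.
apply: complexI; rewrite rmorphXn /= -!nrmE; exact: cstar_normE.
Qed.

Lemma nrm_complete (u : nat -> T) (d : nat -> R) :
  (forall k l, (k <= l)%N -> nrm (u l - u k) <= d k) ->
  (forall k e, 0 < e -> exists2 l, (k <= l)%N & d l < e) ->
  exists y, forall k e, 0 < e -> nrm (y - u k) <= d k + e.
Proof.
move=> hu hd.
have cu : cvg (u @ \oo).
  apply/cauchy_cvgP/cauchy_exP => _ /ltc0P[e e0 ->].
  have [k _ hk] := hd 0 _ e0; exists (u k).
  suff: \forall l \near \oo, ball (u k) e%:C (u l) by [].
  near=> l.
  rewrite -ball_normE /= distrC nrmE ltcR; apply: le_lt_trans hk.
  by apply: hu; near: l; exact: nbhs_infty_ge.
exists (lim (u @ \oo)) => k e e0.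
have /cvgrPdist_lt/(_ e%:C) := cu; rewrite ltcR => /(_ e0) he.
near \oo => l.
have -> : lim (u @ \oo) - u k = (u l - u k) + (lim (u @ \oo) - u l).
  by zmod_eq.
apply: le_trans (nrmD _ _) _; apply: lerD.
  by apply: hu; near: l; exact: nbhs_infty_ge.
by apply: ltW; rewrite -ltcR -nrmE; near: l.
Unshelve. all: by end_near.
Qed.

End CStarNorm.

(** * Positive elements of a C*-algebra and Kaplansky's theorem *)

Section CStarPositivity.
Variables (R : realType) (T : cstarAlgType R).
Implicit Types (x y h k p c d : T) (r s t e : R).

Local Notation "t %:T" := (t%:C *: (1 : T)) : ring_scope.

Lemma scmulAl (a : R[i]) x y : a *: x * y = a *: (x * y).
Proof. by symmetry; exact: cstar_scaleAl. Qed.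

Lemma scmulAr (a : R[i]) x y : x * (a *: y) = a *: (x * y).
Proof. by symmetry; exact: cstar_scaleAr. Qed.

Lemma csD x y : cstar (x + y) = cstar x + cstar y.
Proof. exact: cstarD. Qed.

Lemma csM x y : cstar (x * y) = cstar y * cstar x.
Proof. exact: cstarM. Qed.

Lemma cs0 : cstar 0 = 0 :> T.
Proof. by apply: (addrI (cstar 0)); rewrite -csD !addr0. Qed.

Lemma csN x : cstar (- x) = - cstar x.
Proof. by apply: (addrI (cstar x)); rewrite -csD !subrr cs0. Qed.

Lemma conjCE (a : R[i]) : (a^*)%R = conjc a.
Proof. by []. Qed.

Lemma csZr r x : cstar (r%:C *: x) = r%:C *: cstar x.
Proof. by rewrite cstarZ conjCE conjc_real. Qed.

Lemma cs1 : cstar 1 = 1 :> T.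
Proof. by rewrite -[LHS]mulr1 -{2}(cstarK 1) -csM mulr1 cstarK. Qed.

Lemma mulii : 'i%C * 'i%C = -1 :> R[i].
Proof. by rewrite -expr2 sqr_i. Qed.

Lemma csi x : cstar ('i%C *: x) = - ('i%C *: cstar x).
Proof.
rewrite cstarZ -scaleNr conjCE; congr (_ *: _).
by apply/eqP; rewrite eq_complex /= oppr0 !eqxx. Qed.

(** Equality fails in the zero algebra, which is allowed; the C*-identity only leaves the values 0
    and 1. *)
Lemma nrm1_le1 : nrm (1 : T) <= 1.
Proof.
have := nrm_sqr (1 : T); rewrite cs1 mul1r => h.
by have := nrm_ge0 (1 : T); nra.
Qed.

Lemma nrm_scalar r : 0 <= r -> nrm (r%:T) <= r.
Proof. by move=> r0; rewrite nrmZr ger0_norm // ler_piMr // nrm1_le1. Qed.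

Lemma nrm_cs_le x : nrm x <= nrm (cstar x).
Proof.
have := nrmM (cstar x) x; rewrite nrm_sqr.
by have := nrm_ge0 x; have := nrm_ge0 (cstar x); nra.
Qed.

Lemma nrm_cs x : nrm (cstar x) = nrm x.
Proof. by apply/le_anti; rewrite nrm_cs_le -{2}[x]cstarK nrm_cs_le. Qed.

Lemma nrm_small_eq0 x r : (forall e, 0 < e -> nrm x <= r * e) -> x = 0.
Proof.
move=> hx; apply: nrm_eq0; rewrite leNgt; apply/negP => x0.
have r0 : 0 < r by have := hx 1 ltr01; lra.
have := hx (nrm x / (2 * r)); rewrite divr_gt0 ?mulr_gt0 // => /(_ isT).
rewrite (_ : r * _ = nrm x / 2); first lra.
by field; rewrite gt_eqF.
Qed.

(** Positivity without spectral theory: for self-adjoint [h] the norm bound places the spectrum in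
    the interval [[0, 2t]]. In this form, stability under sums is just the triangle inequality. *)
Definition psd h := cstar h = h /\ exists2 t, 0 <= t & nrm (t%:T - h) <= t.

Lemma psd_sa h : psd h -> cstar h = h. Proof. by case. Qed.

Lemma nrm_shift t s h : t <= s -> nrm (t%:T - h) <= t ->
  nrm (s%:T - h) <= s.
Proof.
move=> ts ht; have -> : s%:T - h = (t%:T - h) + (s - t)%:T.
  by lmod_eq.
apply: le_trans (nrmD _ _) _.
by have := @nrm_scalar (s - t); rewrite subr_ge0 => /(_ ts); lra.
Qed.

Lemma psdD h k : psd h -> psd k -> psd (h + k).
Proof.
move=> [sh [t t0 ht]] [sk [s s0 hs]]; split; first by rewrite csD sh sk.
exists (t + s); first exact: addr_ge0.
have -> : (t + s)%:T - (h + k) = (t%:T - h) + (s%:T - k) by lmod_eq.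
by apply: le_trans (nrmD _ _) _; exact: lerD.
Qed.

Lemma psdZ r h : 0 <= r -> psd h -> psd (r%:C *: h).
Proof.
move=> r0 [sh [t t0 ht]]; split; first by rewrite csZr sh.
exists (r * t); first exact: mulr_ge0.
have -> : (r * t)%:T - r%:C *: h = r%:C *: (t%:T - h) by lmod_eq.
by rewrite nrmZr ger0_norm // ler_wpM2l.
Qed.

Lemma psd0 : psd 0.
Proof. by split; rewrite ?cs0 //; exists 0; rewrite ?scale0r ?subrr ?nrm0. Qed.

Lemma psd_ub h t : cstar h = h -> nrm h <= t -> psd (t%:T - h).
Proof.
move=> sh ht; split; first by rewrite csD csN csZr cs1 sh.
exists t; first exact: le_trans (nrm_ge0 _) ht.
by rewrite opprB addrC subrK.
Qed.

Lemma psd_scalar t : 0 <= t -> psd (t%:T).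
Proof. by move=> t0; have := @psd_ub 0 t; rewrite cs0 nrm0 subr0; exact. Qed.

Lemma half_double x : (2^-1)%:C *: x + (2^-1)%:C *: x = x.
Proof.
by rewrite -scalerDl -rmorphD (_ : _ + _ = 1) ?scale1r //=; lra.
Qed.

(** After enlarging [t] to be nonzero, [z = 1 - h / t] has norm at most 1, and the iteration gives
    [(1 - y)^2 = h / t]. The iterates are built from [z] alone, so the root commutes with everything
    that commutes with [h]. *)
Lemma psd_sqrt h : psd h -> exists w,
  [/\ psd w, w * w = h & forall c, c * h = h * c -> c * w = w * c].
Proof.
case=> sh [t0 t00 ht0]; pose t := t0 + 1.
have t_gt0 : 0 < t by rewrite /t; lra.
have ht : nrm (t%:T - h) <= t by apply: nrm_shift ht0; rewrite /t; lra.
pose z : T := 1 - (t^-1)%:C *: h.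
have nz : nrm z <= 1.
  have -> : z = (t^-1)%:C *: (t%:T - h).
    by rewrite scalerBr scalerA -rmorphM /= mulVf ?gt_eqF // scale1r.
  by rewrite nrmZr ger0_norm ?invr_ge0 ?(ltW t_gt0) // mulrC ler_pdivrMr // mul1r.
pose half x := (2^-1)%:C *: x.
have [|||||||||||y [hy ny hC]] :=
  @sqrt_iteration R T half (fun x r => nrm x <= r) z.
- by move=> x y; rewrite /half scalerBr.
- exact: half_double.
- by rewrite nrm0.
- by move=> x r; rewrite nrmN.
- by move=> x y r s hx hy; apply: le_trans (nrmD _ _) _; exact: lerD.
- move=> x y r s hx hy; apply: le_trans (nrmM _ _) _.
  by apply: ler_pM => //; exact: nrm_ge0.
- move=> x r hx; rewrite nrmZr ger0_norm ?invr_ge0 ?ler0n //; lra.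
- by move=> x r s; exact: le_trans.
- by move=> x hx; apply: (@nrm_small_eq0 _ 1) => e; rewrite mul1r; exact: hx.
- exact: nrm_complete.
- exact: nz.
have sz : cstar z = z by rewrite csD csN csZr cs1 sh.
have sy : cstar y = y.
  apply/eqP; rewrite -subr_eq0; apply/eqP; apply: (@nrm_small_eq0 _ 2) => e e0.
  have [v sv hv] : exists2 v, cstar v = v & nrm (y - v) <= e.
    apply: hC => //; first exact: cs0.
    by move=> v sv; rewrite /half csZr csD csM sv sz.
  have -> : cstar y - y = cstar (y - v) - (y - v).
    by rewrite csD csN sv; zmod_eq.
  by apply: le_trans (nrmD _ _) _; rewrite nrmN nrm_cs; lra.
pose s := Num.sqrt t; have s0 : 0 <= s by exact: sqrtr_ge0.
exists (s%:C *: (1 - y)); split.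
- split; first by rewrite csZr csD csN cs1 sy.
  exists s => //; rewrite -scalerBr opprB addrC subrK nrmZr ger0_norm //.
  rewrite ler_piMr //; apply/ler_addgt0Pr; exact: ny.
- rewrite scmulAl scmulAr hy scalerA -rmorphM /= -expr2 sqr_sqrtr ?(ltW t_gt0) //.
  by rewrite opprB addrC subrK scalerA -rmorphM /= mulfV ?gt_eqF // scale1r.
- move=> c hc; rewrite scmulAr scmulAl mulrBr mulrBl mulr1 mul1r.
  congr (_ *: (_ - _)); apply/eqP; rewrite -subr_eq0; apply/eqP.
  apply: (@nrm_small_eq0 _ (2 * nrm c)) => e e0.
  have [v cv hv] : exists2 v, c * v = v * c & nrm (y - v) <= e.
    apply: hC => //; first by rewrite mulr0 mul0r.
    move=> v cv; rewrite /half scmulAl scmulAr; congr (_ *: _).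
    rewrite /z !(mulrDr, mulrDl, mulrN, mulNr) mul1r mulr1 scmulAr scmulAl hc.
    by rewrite mulrA cv -mulrA cv mulrA.
  have -> : c * y - y * c = c * (y - v) - (y - v) * c.
    by rewrite mulrBr mulrBl cv; zmod_eq.
  apply: le_trans (nrmD _ _) _; rewrite nrmN.
  have h1 := nrmM c (y - v); have h2 := nrmM (y - v) c.
  have c0 := nrm_ge0 c; nra.
Qed.

(* [c + i d] is normal, with [(c + i d)^* (c + i d) = c^2 + d^2]. *)
Lemma nrm_sqr_le_sumsq c d : cstar c = c -> cstar d = d -> c * d = d * c ->
  nrm c ^+ 2 <= nrm (c * c + d * d).
Proof.
move=> sc sd cd; pose u := c + 'i%C *: d.
have su : cstar u = c - 'i%C *: d by rewrite csD csi sc sd.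
have <- : cstar u * u = c * c + d * d.
  rewrite su /u mulrDr !mulrBl !scmulAr !scmulAl scalerA cd.
  rewrite mulii scaleN1r; zmod_eq.
rewrite nrm_sqr ler_sqr ?nnegrE ?nrm_ge0 //.
have : nrm (c + c) <= nrm u + nrm u.
  rewrite -{2}(nrm_cs u) su; apply: le_trans (nrmD _ _).
  by rewrite addrACA subrr addr0.
have -> : c + c = 2%:C *: c.
  by rewrite rmorphD /= rmorph1 scalerDl scale1r.
rewrite nrmZr ger0_norm ?ler0n //; lra.
Qed.

(** The element [1 - k^2] has a root [w] commuting with [k], so [w^2 + k^2 = 1] bounds [w] by
    [nrm_sqr_le_sumsq]. This is what makes squares of self-adjoint elements [psd]. *)
Lemma nrm_1Bsqr k : cstar k = k -> nrm k <= 1 -> nrm (1 - k * k) <= 1.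
Proof.
move=> sk k1; have nkk : nrm (k * k) <= 1.
  by have := nrmM k k; have := nrm_ge0 k; nra.
have [|w [hw ww cw]] := @psd_sqrt (1 - k * k).
  by have := @psd_ub (k * k) 1; rewrite rmorph1 scale1r csM sk; exact.
have kw : k * w = w * k.
  by apply: cw; rewrite mulrBr mulrBl mulr1 mul1r mulrA.
have := nrm_sqr_le_sumsq (psd_sa hw) sk (esym kw).
rewrite ww subrK => h; have := nrm1_le1; have := nrmM w w.
by rewrite ww -expr2; lra.
Qed.

Lemma psd_sqr k : cstar k = k -> psd (k * k).
Proof.
move=> sk; pose s := nrm k + 1.
have s0 : 0 < s by have := nrm_ge0 k; rewrite /s; lra.
have -> : k * k = (s * s)%:C *: ((s^-1)%:C *: k * ((s^-1)%:C *: k)).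
  have e : s * s * s^-1 * s^-1 = 1 by field; rewrite gt_eqF.
  by rewrite scmulAl scmulAr -[LHS]scale1r -(rmorph1 (real_complex R)) -e; lmod_eq.
apply: psdZ; first by rewrite mulr_ge0 // ltW.
have sk' : cstar ((s^-1)%:C *: k) = (s^-1)%:C *: k by rewrite csZr sk.
split; first by rewrite csM sk'.
exists 1 => //; rewrite rmorph1 scale1r; apply: nrm_1Bsqr => //.
rewrite nrmZr ger0_norm ?invr_ge0 ?(ltW s0) // mulrC ler_pdivrMr // /s; lra.
Qed.

(** Makes the witness in [psd] uniform: any positive bound on the norm will do. Closedness of the
    cone depends on this. *)
Lemma psd_nrm h t : psd h -> 0 < t -> nrm h <= t -> nrm (t%:T - h) <= t.
Proof.
move=> /psd_sqrt[w [[sw _] <- _]] t0 ht.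
pose s := Num.sqrt t; have s0 : 0 < s by rewrite sqrtr_gt0.
have ss : s * s = t by rewrite -expr2 sqr_sqrtr // ltW.
pose k := (s^-1)%:C *: w.
have -> : t%:T - w * w = t%:C *: (1 - k * k).
  rewrite scalerBr /k scmulAl scmulAr !scalerA -!rmorphM /= -invfM ss.
  by rewrite mulfV ?gt_eqF // scale1r.
have sk : cstar k = k by rewrite csZr sw.
rewrite nrmZr ger0_norm ?ler_piMr ?(ltW t0) //; apply: nrm_1Bsqr => //.
rewrite -(@ler_sqr R) ?nnegrE ?nrm_ge0 // expr1n -nrm_sqr sk.
rewrite /k scmulAl scmulAr !scalerA -!rmorphM /= -invfM ss.
by rewrite nrmZr ger0_norm ?invr_ge0 ?(ltW t0) // mulrC ler_pdivrMr // mul1r.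
Qed.

Lemma psd_closed h : (forall e, 0 < e -> psd (h + e%:T)) -> psd h.
Proof.
move=> hh; have sh : cstar h = h.
  by have := psd_sa (hh 1 ltr01); rewrite csD csZr cs1 => /addIr.
split=> //; pose t := nrm h + 1; exists t.
  by have := nrm_ge0 h; rewrite /t; lra.
have t1 : 1 <= t by have := nrm_ge0 h; rewrite /t; lra.
apply/ler_addgt0Pr => e e0; pose d := Num.min 1 e.
have d0 : 0 < d by rewrite lt_min ltr01.
have d1 : d <= 1 by rewrite ge_min lexx.
have de : d <= e by rewrite ge_min lexx orbT.
have : nrm (t%:T - (h + d%:T)) <= t.
  apply: psd_nrm; [exact: hh|lra|]; apply: le_trans (nrmD _ _) _.
  by have := nrm_scalar (ltW d0); rewrite /t; lra.
have -> : t%:T - h = (t%:T - (h + d%:T)) + d%:T by zmod_eq.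
move=> hd; apply: le_trans (nrmD _ _) _.
by have := nrm_scalar (ltW d0); lra.
Qed.

(** The roots [c] of [p] and [d] of [r - p] commute, and [c^2 + d^2 = r] bounds the norm of [c] by
    [nrm_sqr_le_sumsq]. *)
Lemma psd_nrm_le r p : psd p -> psd (r%:T - p) -> 0 <= r -> nrm p <= r.
Proof.
move=> /psd_sqrt[c [[sc _] cc _]] /psd_sqrt[d [[sd _] dd cd]] r0.
have cp : c * d = d * c.
  by apply: cd; rewrite mulrBr mulrBl -cc scmulAr scmulAl mulr1 mul1r mulrA.
have := nrm_sqr_le_sumsq sc sd cp; rewrite cc dd addrC subrK => h.
have := nrm_scalar r0; have := nrmM c c; rewrite cc -expr2; lra.
Qed.

Lemma psd_anti p : psd p -> psd (- p) -> p = 0.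
Proof.
move=> h1 h2; apply: nrm_eq0; apply: psd_nrm_le => //.
by rewrite rmorph0 scale0r sub0r.
Qed.

Lemma psd_addcs y : psd (cstar y * y + y * cstar y).
Proof.
pose u := y + cstar y; pose v := 'i%C *: (y - cstar y).
have su : cstar u = u by rewrite csD cstarK addrC.
have sv : cstar v = v by rewrite csi csD csN cstarK -scalerN opprB.
have -> : cstar y * y + y * cstar y = (2^-1)%:C *: (u * u + v * v).
  have -> : u * u + v * v = (cstar y * y + y * cstar y) + (cstar y * y + y * cstar y).
    rewrite /u /v scmulAl scmulAr scalerA mulii scaleN1r.
    by rewrite !(mulrDl, mulrDr, mulrN, mulNr); zmod_eq.
  by rewrite scalerDr half_double.
by apply: psdZ; [rewrite invr_ge0 ler0n|apply: psdD; exact: psd_sqr].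
Qed.

Lemma sa_exp h n : cstar h = h -> cstar (h ^+ n) = h ^+ n.
Proof.
move=> sh; elim: n => [|n IH]; first by rewrite expr0 cs1.
by rewrite exprS csM IH sh -exprSr exprS.
Qed.

Lemma nrm_exp_sa h n : cstar h = h -> nrm (h ^+ (2 ^ n)) = nrm h ^+ (2 ^ n).
Proof.
move=> sh; elim: n => [|n IH]; first by rewrite expn0 !expr1.
by rewrite expnSr !exprM -IH -nrm_sqr sa_exp // -expr2.
Qed.

Lemma bernoulli (d : R) n : 0 <= d -> 1 + n%:R * d <= (1 + d) ^+ n.
Proof.
move=> d0; elim: n => [|n IH]; first by rewrite mul0r addr0 expr0.
rewrite exprS -natr1; have n0 : 0 <= n%:R :> R by [].
have := ler_wpM2l (_ : 0 <= 1 + d) IH; rewrite addr_ge0 // => /(_ isT).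
by have := mulr_ge0 n0 (sqr_ge0 d); rewrite expr2; nra.
Qed.

(** Bernoulli's inequality is itself linear in the exponent, so it is applied to half the exponent
    and then squared. Exponents are powers of two because the C*-identity computes only those
    norms. *)
Lemma exp_linear_growth_le1 (x : R) :
  (forall n, x ^+ (2 ^ n) <= 1 + (2 ^ n)%:R) -> x <= 1.
Proof.
move=> hx; rewrite leNgt; apply/negP => x1; pose d := x - 1.
have d0 : 0 < d by rewrite /d; lra.
(* With [m = 2 ^ n] this gives [m d^2 > 2], hence [(1 + m d)^2 > 1 + 2 m]. *)
pose n := (Num.truncn (2 / d ^+ 2)).+1.
have h1 : 2 / d ^+ 2 < n%:R by exact: truncnS_gt.
have h2 : n%:R <= (2 ^ n)%:R :> R by rewrite ler_nat ltnW // ltn_expl.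
have := hx n.+1; rewrite expnSr exprM natrM.
have := bernoulli (2 ^ n) (ltW d0); rewrite (_ : 1 + d = x); last by rewrite /d; lra.
move: h2; set m : R := (2 ^ n)%:R; set X := x ^+ (2 ^ n) => h2 h3.
have m0 : 0 < m by apply: lt_le_trans h2; rewrite ltr0n.
move: h1; rewrite ltr_pdivrMr ?exprn_gt0 // => h1 h4.
have md : 2 < m * d ^+ 2.
  by apply: lt_le_trans h1 _; rewrite ler_pM2r ?exprn_gt0.
have h5 : (1 + m * d) ^+ 2 <= X ^+ 2.
  by rewrite ler_sqr ?nnegrE; [| have := mulr_gt0 m0 d0; lra..].
have h6 : m * 2 < m * (m * d ^+ 2) by rewrite ltr_pM2l.
have := mulr_gt0 m0 d0; move: h4 h5 h6; rewrite !expr2; nra.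
Qed.

(* Kaplansky: with [a = - y^* y] and [b = y y^*] both positive,
   [(1 + a)^m a = - y^* (1 - b)^m y] stays bounded, so [|(1 + a)^m|] grows at
   most linearly in m; as [1 + a] is self-adjoint, its norm is then at most 1. *)
Lemma psd_opp_csM y : psd (- (cstar y * y)) -> cstar y * y = 0.
Proof.
wlog ny : y / nrm y <= 1 => [wl|].
  move=> hy; pose s := nrm y + 1.
  have s0 : 0 < s by have := nrm_ge0 y; rewrite /s; lra.
  have e1 : cstar ((s^-1)%:C *: y) * ((s^-1)%:C *: y) =
      (s^-1 * s^-1)%:C *: (cstar y * y).
    by rewrite csZr scmulAl scmulAr scalerA -rmorphM.
  have := wl ((s^-1)%:C *: y); rewrite e1 => h.
  have : (s^-1 * s^-1)%:C *: (cstar y * y) = 0.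
    apply: h.
      rewrite nrmZr ger0_norm ?invr_ge0 ?(ltW s0) // mulrC ler_pdivrMr // /s; lra.
    by rewrite -scalerN; apply: psdZ => //; rewrite mulr_ge0 // invr_ge0 ltW.
  move/eqP; rewrite scaler_eq0 => /orP[|/eqP //].
  by rewrite -[0]/(0%:C) (inj_eq (@complexI _)) mulf_eq0 orbb invr_eq0 gt_eqF.
move=> ha; set a := - _ in ha; pose b := y * cstar y; pose g := 1 + a.
have hb : psd b.
  by rewrite (_ : b = (cstar y * y + b) + a);
    [apply: psdD => //; exact: psd_addcs|rewrite /a; zmod_eq].
have nb : nrm b <= 1.
  apply: le_trans (nrmM _ _) _; rewrite nrm_cs.
  by have := nrm_ge0 y; nra.
have n1b : nrm (1 - b) <= 1.
  by have := psd_nrm hb ltr01 nb; rewrite rmorph1 scale1r.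
have bd m : nrm (g ^+ m * a) <= 1.
  have -> : g ^+ m * a = - (cstar y * (1 - b) ^+ m * y).
    suff -> : cstar y * (1 - b) ^+ m = g ^+ m * cstar y by rewrite mulrN -mulrA.
    elim: m => [|m IH]; first by rewrite !expr0 mulr1 mul1r.
    rewrite !exprSr mulrA IH -!mulrA; congr (_ * _).
    by rewrite mulrBr mulrDl mulr1 mul1r /a mulNr -mulrA.
  rewrite nrmN; apply: le_trans (nrmM _ _) _.
  have h1 : nrm ((1 - b) ^+ m) <= 1.
    elim: m => [|m IH]; first exact: nrm1_le1.
    rewrite exprS; apply: le_trans (nrmM _ _) _.
    by have := nrm_ge0 (1 - b); have := nrm_ge0 ((1 - b) ^+ m); nra.
  have := nrmM (cstar y) ((1 - b) ^+ m); rewrite nrm_cs => h2.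
  have := nrm_ge0 y; have := nrm_ge0 ((1 - b) ^+ m).
  have := nrm_ge0 (cstar y * (1 - b) ^+ m); nra.
have gm m : nrm (g ^+ m) <= 1 + m%:R.
  elim: m => [|m IH]; first by rewrite addr0 nrm1_le1.
  rewrite exprSr {2}/g mulrDr mulr1 -natr1.
  by apply: le_trans (nrmD _ _) _; have := bd m; lra.
have sg : cstar g = g by rewrite csD cs1 (psd_sa ha).
have ng : nrm g <= 1.
  by apply: exp_linear_growth_le1 => n; rewrite -nrm_exp_sa.
have hNa : psd (- a).
  have := psd_ub sg ng; rewrite rmorph1 scale1r.
  by rewrite (_ : 1 - g = - a) // /g; zmod_eq.
by have /eqP := psd_anti ha hNa; rewrite oppr_eq0 => /eqP.
Qed.

(** Here [q] is the absolute value of [h = x^* x], and [n = q - h] is twice its negative part. Since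
    [h n = - q n], the element [x n] has square [- (e n)^2] with [e] the root of [q], so it vanishes
    by [psd_opp_csM]. This forces [n^4 = 0], then [n = 0] by the C*-identity, and [h = q]. *)
Lemma psd_csM x : psd (cstar x * x).
Proof.
set h := cstar x * x.
have sh : cstar h = h by rewrite csM cstarK.
have [q [hq qq cq]] := psd_sqrt (psd_sqr sh).
have [e [[se _] ee ce]] := psd_sqrt hq.
have hqc : h * q = q * h by apply: cq; rewrite mulrA.
have hec : h * e = e * h by apply: ce.
have qec : q * e = e * q by rewrite -ee mulrA.
pose n := q - h.
have sn : cstar n = n by rewrite csD csN (psd_sa hq) sh.
have nqc : n * q = q * n by rewrite mulrBl mulrBr hqc.
have nec : n * e = e * n by rewrite mulrBl mulrBr hec qec.
have hn : h * n = - (q * n) by rewrite !mulrBr hqc qq opprB.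
have nn : n * n = q * n + q * n.
  by rewrite {1}/n mulrBl hn opprK.
have yy : cstar (x * n) * (x * n) = - (e * n * (e * n)).
  rewrite csM sn mulrA -(mulrA n) -/h -(mulrA n) hn mulrN; congr (- _).
  by rewrite -ee !mulrA nec.
have sen : cstar (e * n) = e * n by rewrite csM sn se nec.
have : cstar (x * n) * (x * n) = 0.
  by apply: psd_opp_csM; rewrite yy opprK; exact: psd_sqr.
rewrite yy => /eqP; rewrite oppr_eq0 => /eqP enen.
have qnn : q * (n * n) = 0.
  by rewrite -enen -ee !mulrA -(mulrA e n e) nec mulrA.
have nnn : n * n * (n * n) = 0.
  by rewrite {1}nn mulrDl -nqc -mulrA qnn mulr0 addr0.
have n0 : n = 0.
  have nn0 : n * n = 0.
    apply: nrm_eq0; have := nrm_sqr (n * n); rewrite csM sn nnn nrm0.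
    by have := nrm_ge0 (n * n); nra.
  apply: nrm_eq0; have := nrm_sqr n; rewrite sn nn0 nrm0.
  by have := nrm_ge0 n; nra.
by move/eqP: n0; rewrite subr_eq0 => /eqP <-.
Qed.

Lemma psd_conj h y : psd h -> psd (cstar y * h * y).
Proof.
move=> /psd_sqrt[w [[sw _] <- _]].
have -> : cstar y * (w * w) * y = cstar (w * y) * (w * y).
  by rewrite csM sw !mulrA.
exact: psd_csM.
Qed.

End CStarPositivity.

(** * States detect positivity in a C*-algebra *)

Section States.
Variables (R : realType) (T : cstarAlgType R).
Implicit Types (x y h : T) (t : R).

Local Notation "t %:T" := (t%:C *: (1 : T)) : ring_scope.

Lemma real_linearN (V : lmodType R[i]) (g : V -> R) v : real_linear g -> g (- v) = - g v.
Proof.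
by move=> hg; rewrite -scaleN1r -[1](rmorph1 (real_complex R)) -rmorphN hg.2 mulN1r.
Qed.

Definition herm_part x : T := (2^-1)%:C *: (x + cstar x).

Lemma herm_partD x y : herm_part (x + y) = herm_part x + herm_part y.
Proof. by rewrite /herm_part csD; lmod_eq. Qed.

Lemma herm_partZ (r : R) x : herm_part (r%:C *: x) = r%:C *: herm_part x.
Proof. by rewrite /herm_part csZr; lmod_eq. Qed.

Lemma herm_part_sa x : cstar (herm_part x) = herm_part x.
Proof. by rewrite /herm_part csZr csD cstarK addrC. Qed.

Lemma herm_part_id x : cstar x = x -> herm_part x = x.
Proof. by move=> sx; rewrite /herm_part sx scalerDr half_double. Qed.

Lemma psd_scalar_ge0 t : (1 : T) <> 0 -> psd t%:T -> 0 <= t.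
Proof.
move=> T1 ht; rewrite leNgt; apply/negP => t0.
have := psd_anti ht; rewrite -scaleNr -rmorphN => /(_ (psd_scalar _ _)).
rewrite oppr_ge0 => /(_ (ltW t0)) /eqP; rewrite scaler_eq0 => /orP[|/eqP //].
by rewrite -[0]/(0%:C) (inj_eq (@complexI _)) lt_eqF.
Qed.

Definition is_state (phi : T -> R[i]) : Prop :=
  [/\ forall (a : R[i]) x y, phi (a *: x + y) = a * phi x + phi y,
      forall x, psd x -> 0 <= phi x & phi 1 = 1].

(** By closedness some [h + e] is still not positive, which says that [p (- h) >= e]. Mazur-Orlicz
    at the single point [- h] then gives [g] with [g h < 0], and [g <= p] alone makes [g] positive
    and unital. *)
Lemma exists_state_not_ge0 h : cstar h = h -> ~ psd h ->
  exists2 phi, is_state phi & ~ (0 <= phi h).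
Proof.
move=> sh hN.
have T1 : (1 : T) <> 0.
  by move=> T1; apply: hN; rewrite -[h]mulr1 T1 mulr0; exact: psd0.
have [e e0 he] : exists2 e, 0 < e & ~ psd (h + e%:T).
  apply: contrapT => H; apply/hN/psd_closed => e e0.
  by apply: contrapT => he; apply: H; exists e.
(* The infimum [p x] of this set is the largest spectral value of the hermitian part of [x],
   expressed through the order only. *)
pose U x := [set t : R | psd (t%:T - herm_part x)].
have Ulb x t : U x t -> - nrm (herm_part x) <= t.
  move=> hx; have := psd_ub (_ : cstar (- herm_part x) = _) (lexx (nrm (- herm_part x))).
  rewrite csN herm_part_sa nrmN opprK => /(_ erefl) /(psdD hx).
  have -> : t%:T - herm_part x + ((nrm (herm_part x))%:T + herm_part x) =
    (t + nrm (herm_part x))%:T by lmod_eq.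
  by move/(psd_scalar_ge0 T1); lra.
have Unrm x : U x (nrm (herm_part x)) by apply: psd_ub => //; exact: herm_part_sa.
pose p x := inf (U x).
have ple x t : U x t -> p x <= t.
  by move=> xt; apply: ge_inf => //; exists (- nrm (herm_part x)) => s /Ulb.
have lep x c : (forall t, U x t -> c <= t) -> c <= p x.
  by move=> hc; apply: lb_le_inf => //; exists (nrm (herm_part x)).
have hp : sublinear p.
  have r0 : herm_part 0 = 0 by rewrite herm_part_id // cs0.
  apply: sublinearP.
  - apply/le_anti/andP; split.
      by apply: ple; rewrite /U /= r0 scale0r subrr; exact: psd0.
    by apply: lep => t; rewrite /U /= r0 subr0; exact: psd_scalar_ge0.
  - move=> x y; rewrite -lerBlDr; apply: (lep) => t xt.
    rewrite lerBlDr -lerBlDl; apply: lep => s ys; rewrite lerBlDl.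
    apply: ple; rewrite /U /= herm_partD.
    have -> : (t + s)%:T - (herm_part x + herm_part y) =
      (t%:T - herm_part x) + (s%:T - herm_part y) by lmod_eq.
    exact: psdD.
  - move=> r x r_gt0; rewrite -ler_pdivrMl //; apply: (lep) => t xt.
    rewrite ler_pdivrMl //; apply: ple; rewrite /U /= herm_partZ.
    have -> : (r * t)%:T - r%:C *: herm_part x = r%:C *: (t%:T - herm_part x) by lmod_eq.
    by apply: psdZ => //; exact: ltW.
have pe d : d = - h -> e <= p d.
  move=> ->; apply: lep => t; rewrite /U /= herm_part_id ?csN ?sh // opprK => ht.
  rewrite leNgt; apply/negP => te; apply: he.
  have -> : h + e%:T = (t%:T + h) + (e - t)%:T by lmod_eq.
  by apply: psdD => //; apply: psd_scalar; rewrite subr_ge0 ltW.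
have [||g [hg gp gh]] := mazur_orlicz hp _ _ pe; first by exists (- h).
  by move=> r s _ _ _ _ rs -> ->; rewrite -scalerDl -rmorphD rs scale1r.
have g_ge0 x : psd x -> 0 <= g x.
  move=> hx; rewrite -oppr_le0 -(real_linearN _ hg).
  apply: le_trans (gp _) _; apply: ple; rewrite /U /= herm_part_id.
    by rewrite opprK scale0r add0r.
  by rewrite csN (psd_sa hx).
have gi_le0 x : cstar x = x -> g ('i%C *: x) <= 0.
  move=> sx; apply: le_trans (gp _) _; apply: ple; rewrite /U /= /herm_part csi sx.
  by rewrite subrr scaler0 scale0r subrr; exact: psd0.
have gi x : cstar x = x -> g ('i%C *: x) = 0.
  move=> sx; apply/le_anti; rewrite gi_le0 //= -oppr_le0 -(real_linearN _ hg).
  by rewrite -scalerN gi_le0 // csN sx.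
have gh_lt0 : g h < 0.
  by have := gh _ erefl; rewrite (real_linearN _ hg); lra.
have g1 : g 1 = 1.
  apply/le_anti/andP; split.
    apply: le_trans (gp _) _; apply: ple; rewrite /U /= herm_part_id ?cs1 //.
    by rewrite rmorph1 scale1r subrr; exact: psd0.
  rewrite -lerN2 -(real_linearN _ hg); apply: le_trans (gp _) _; apply: ple.
  rewrite /U /= herm_part_id ?csN ?cs1 // rmorphN rmorph1 scaleN1r subrr.
  exact: psd0.
(* The usual complexification of a real-linear functional; it is real on self-adjoint elements
   because [g] vanishes on their multiples by [i]. *)
exists (fun x => g x +i* (- g ('i%C *: x))); last first.
  by rewrite lecE /= => /andP[_]; rewrite leNgt gh_lt0.
split.
- have gZ (a : R[i]) x : g (a *: x) = complex.Re a * g x + complex.Im a * g ('i%C *: x).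
    rewrite {1}(complexE a) scalerDl hg.1 hg.2; congr (_ + _).
    by rewrite mulrC -scalerA hg.2.
  move=> a x y; rewrite scalerDr !hg.1 scalerA gZ (gZ (_ * _)).
  apply/eqP; rewrite eq_complex; case: a => u v /=; apply/andP; split; apply/eqP; ring.
- move=> x hx; rewrite lecE /= g_ge0 // gi ?oppr0 ?eqxx //; exact: psd_sa.
- by rewrite g1 gi ?cs1 // oppr0.
Qed.

End States.

(** * Positive matrices over a C*-algebra, acting on the Hilbert module [T^n] *)

Section MatrixPositivity.
Variables (R : realType) (T : cstarAlgType R).
Implicit Types (r s t e : R) (x y : T).

Definition dot n (v w : 'cV[T]_n) : T := \sum_i cstar (v i 0) * w i 0.

Definition rscale m n r (X : 'M[T]_(m, n)) : 'M[T]_(m, n) := map_mx ( *:%R r%:C) X.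

Lemma cs_sum I (s : seq I) (P : pred I) (F : I -> T) :
  cstar (\sum_(i <- s | P i) F i) = \sum_(i <- s | P i) cstar (F i).
Proof. exact: (big_morph _ (@csD R T) (@cs0 R T)). Qed.

Lemma mxstarE n (X : 'M[T]_n) i j : mxstar cstar X i j = cstar (X j i).
Proof. by rewrite !mxE. Qed.

Lemma mxstarK n (X : 'M[T]_n) : mxstar cstar (mxstar cstar X) = X.
Proof. by apply/matrixP => i j; rewrite !mxstarE cstarK. Qed.

Lemma mxstarM n (X Y : 'M[T]_n) :
  mxstar cstar (X *m Y) = mxstar cstar Y *m mxstar cstar X.
Proof.
apply/matrixP => i j; rewrite mxstarE !mxE cs_sum; apply: eq_bigr => k _.
by rewrite csM !mxstarE.
Qed.

Lemma mxstarD n (X Y : 'M[T]_n) :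
  mxstar cstar (X + Y) = mxstar cstar X + mxstar cstar Y.
Proof. by apply/matrixP => i j; rewrite !(mxE, mxstarE) csD. Qed.

Lemma mxstarN n (X : 'M[T]_n) : mxstar cstar (- X) = - mxstar cstar X.
Proof. by apply/matrixP => i j; rewrite !(mxE, mxstarE) csN. Qed.

Lemma mxstar0 n : mxstar cstar (0 : 'M[T]_n) = 0.
Proof. by apply/matrixP => i j; rewrite !mxE cs0. Qed.

Lemma mxstar1 n : mxstar cstar (1%:M : 'M[T]_n) = 1%:M.
Proof.
apply/matrixP => i j; rewrite !mxE eq_sym.
by case: eqP => _; rewrite ?cs1 ?cs0.
Qed.

Lemma mxstar_rscale n r (X : 'M[T]_n) :
  mxstar cstar (rscale r X) = rscale r (mxstar cstar X).
Proof. by apply/matrixP => i j; rewrite !mxE csZr. Qed.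

Lemma rscale_mull m n p r (X : 'M[T]_(m, n)) (Y : 'M[T]_(n, p)) :
  rscale r X *m Y = rscale r (X *m Y).
Proof.
apply/matrixP => i j; rewrite !mxE scaler_sumr; apply: eq_bigr => k _.
by rewrite mxE scmulAl.
Qed.

Lemma rscale_mulr m n p r (X : 'M[T]_(m, n)) (Y : 'M[T]_(n, p)) :
  X *m rscale r Y = rscale r (X *m Y).
Proof.
apply/matrixP => i j; rewrite !mxE scaler_sumr; apply: eq_bigr => k _.
by rewrite mxE scmulAr.
Qed.

Lemma rscaleA m n r s (X : 'M[T]_(m, n)) : rscale r (rscale s X) = rscale (r * s) X.
Proof. by apply/matrixP => i j; rewrite !mxE scalerA -rmorphM. Qed.

Lemma rscale1 m n (X : 'M[T]_(m, n)) : rscale 1 X = X.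
Proof. by apply/matrixP => i j; rewrite !mxE scale1r. Qed.

Section Dot.
Variable n : nat.
Implicit Types (u v w : 'cV[T]_n) (X Y Z : 'M[T]_n).

Lemma dotDl u v w : dot (u + v) w = dot u w + dot v w.
Proof. by rewrite -big_split; apply: eq_bigr => i _; rewrite mxE csD mulrDl. Qed.

Lemma dotDr u v w : dot w (u + v) = dot w u + dot w v.
Proof. by rewrite -big_split; apply: eq_bigr => i _; rewrite mxE mulrDr. Qed.

Lemma dotNl u v : dot (- u) v = - dot u v.
Proof. by rewrite -sumrN; apply: eq_bigr => i _; rewrite mxE csN mulNr. Qed.

Lemma dotNr u v : dot u (- v) = - dot u v.
Proof. by rewrite -sumrN; apply: eq_bigr => i _; rewrite mxE mulrN. Qed.

Lemma dotZl r u v : dot (rscale r u) v = r%:C *: dot u v.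
Proof. by rewrite scaler_sumr; apply: eq_bigr => i _; rewrite mxE csZr scmulAl. Qed.

Lemma dotZr r u v : dot u (rscale r v) = r%:C *: dot u v.
Proof. by rewrite scaler_sumr; apply: eq_bigr => i _; rewrite mxE scmulAr. Qed.

Definition dotE := (dotDl, dotDr, dotNl, dotNr, dotZl, dotZr).

Lemma dot_cs u v : cstar (dot u v) = dot v u.
Proof. by rewrite cs_sum; apply: eq_bigr => i _; rewrite csM cstarK. Qed.

Lemma psd_sum (I : Type) (s : seq I) (P : pred I) (F : I -> T) :
  (forall i, P i -> psd (F i)) -> psd (\sum_(i <- s | P i) F i).
Proof.
by move=> h; elim/big_ind: _ => //; [exact: psd0|exact: psdD].
Qed.

Lemma psd_dot v : psd (dot v v).
Proof. by apply: psd_sum => i _; exact: psd_csM. Qed.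

Lemma dot_mulmxl X u v : dot (X *m u) v = dot u (mxstar cstar X *m v).
Proof.
rewrite /dot; under eq_bigr do rewrite mxE cs_sum mulr_suml.
rewrite exchange_big; apply: eq_bigr => j _ /=; rewrite mxE mulr_sumr.
by apply: eq_bigr => i _; rewrite csM mxstarE mulrA.
Qed.

Definition mxpsd X := forall v, psd (dot v (X *m v)).

Lemma mxpsd_csM X : mxpsd (mxstar cstar X *m X).
Proof. by move=> v; rewrite -mulmxA -dot_mulmxl; exact: psd_dot. Qed.

Definition dvec (j : 'I_n) : 'cV[T]_n := delta_mx j 0.

Lemma dot_dvec i v : dot (dvec i) v = v i 0.
Proof.
rewrite /dot (bigD1 i) //= big1 ?addr0 => [|k /negPf ki].
  by rewrite mxE !eqxx cs1 mul1r.
by rewrite mxE ki /= cs0 mul0r.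
Qed.

Lemma mul_dvec X i j : (X *m dvec j) i 0 = X i j.
Proof. by rewrite -colE mxE. Qed.

(** The operator norm bound on the Hilbert module, stated in the order of [T] so that no norm on
    matrices has to be formed. *)
Definition opbound X r :=
  0 <= r /\ forall v, psd ((r ^+ 2)%:C *: dot v v - dot (X *m v) (X *m v)).

Lemma opbound_entry X r i j : opbound X r -> nrm (X i j) <= r.
Proof.
case=> r0 /(_ (dvec j)) h.
rewrite -ler_sqr ?nnegrE ?nrm_ge0 // -nrm_sqr.
apply: psd_nrm_le; [exact: psd_csM| |exact: sqr_ge0].
move: h; rewrite dot_dvec mxE !eqxx /=.
rewrite [dot (X *m _) _](bigD1 i) //= mul_dvec => h.
rewrite (_ : _ - _ = (r ^+ 2)%:C *: (1 : T) - (cstar (X i j) * X i j +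
    \sum_(k < n | k != i) cstar ((X *m dvec j) k 0) * (X *m dvec j) k 0) +
    \sum_(k < n | k != i) cstar ((X *m dvec j) k 0) * (X *m dvec j) k 0).
  by apply: psdD h _; apply: psd_sum => k _; exact: psd_csM.
by zmod_eq.
Qed.

Lemma opbound_eq0 X : (forall e, 0 < e -> opbound X e) -> X = 0.
Proof.
move=> h; apply/matrixP => i j; rewrite mxE; apply: (@nrm_small_eq0 _ _ _ 1) => e e0.
by rewrite mul1r; apply: opbound_entry; exact: h.
Qed.

Lemma opbound0 : opbound 0 0.
Proof.
split=> // v; rewrite mul0mx expr0n scale0r sub0r.
have -> : dot (0 : 'cV[T]_n) 0 = 0 by rewrite /dot big1 // => i _; rewrite mxE mulr0.
by rewrite oppr0; exact: psd0.
Qed.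

Lemma opboundN X r : opbound X r -> opbound (- X) r.
Proof. by case=> r0 h; split=> // v; rewrite mulNmx dotNl dotNr opprK. Qed.

Lemma opbound_le X r s : opbound X r -> r <= s -> opbound X s.
Proof.
case=> r0 h rs; split=> [|v]; first exact: le_trans rs.
have -> : (s ^+ 2)%:C *: dot v v - dot (X *m v) (X *m v) =
  ((r ^+ 2)%:C *: dot v v - dot (X *m v) (X *m v)) + (s ^+ 2 - r ^+ 2)%:C *: dot v v.
  by lmod_eq.
apply: psdD => //; apply: psdZ; last exact: psd_dot.
by rewrite subr_ge0 ler_sqr // nnegrE // (le_trans r0).
Qed.

Lemma opboundM X Y r s : opbound X r -> opbound Y s -> opbound (X *m Y) (r * s).
Proof.
case=> r0 hX [s0 hY]; split=> [|v]; first exact: mulr_ge0.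
have := psdD (psdZ (sqr_ge0 r) (hY v)) (hX (Y *m v)); rewrite mulmxA.
by congr psd; rewrite exprMn; lmod_eq.
Qed.

Lemma opbound_rscale X r t : opbound X r -> 0 <= t -> opbound (rscale t X) (t * r).
Proof.
case=> r0 h t0; split=> [|v]; first exact: mulr_ge0.
rewrite rscale_mull !dotE; have := psdZ (sqr_ge0 t) (h v).
by congr psd; rewrite exprMn; lmod_eq.
Qed.

(** In place of Cauchy-Schwarz, the cross terms are absorbed by positivity of the square of
    [c X v - c^-1 Y v]. The choice [c^2 = s / r] makes the total exactly [(r + s)^2]; zero radii are
    treated apart because of the quotients. *)
Lemma opboundD X Y r s : opbound X r -> opbound Y s -> opbound (X + Y) (r + s).
Proof.
have b0 Z : opbound Z 0 -> Z = 0.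
  by move=> hZ; apply: opbound_eq0 => e /ltW e0; exact: opbound_le hZ e0.
move=> hX hY; have [r0 hX2] := hX; have [s0 hY2] := hY.
have [r00|rN] := eqVneq r 0; first by move: hX; rewrite r00 => /b0 ->; rewrite !add0r.
have [s00|sN] := eqVneq s 0; first by move: hY; rewrite s00 => /b0 ->; rewrite !addr0.
have {}r0 : 0 < r by rewrite lt_neqAle eq_sym rN.
have {}s0 : 0 < s by rewrite lt_neqAle eq_sym sN.
split=> [|v]; first exact: addr_ge0 (ltW _) (ltW _).
pose c := Num.sqrt (s / r); have c0 : 0 < c by rewrite sqrtr_gt0 divr_gt0.
have c2 : c * c = s / r by rewrite -expr2 sqr_sqrtr // divr_ge0 // ltW.
have := psdD (psdD (psdZ (_ : 0 <= 1 + s / r) (hX2 v)) (psdZ (_ : 0 <= 1 + r / s) (hY2 v)))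
  (psd_dot (rscale c (X *m v) - rscale c^-1 (Y *m v))).
have rs0 : 0 <= r / s by rewrite divr_ge0 ?ltW.
have sr0 : 0 <= s / r by rewrite divr_ge0 ?ltW.
move=> /(_ (addr_ge0 ler01 sr0) (addr_ge0 ler01 rs0)); congr psd.
set a := X *m v; set b := Y *m v.
have -> : dot (rscale c a - rscale c^-1 b) (rscale c a - rscale c^-1 b) =
    (s / r)%:C *: dot a a - dot a b - dot b a + (r / s)%:C *: dot b b.
  have -> : r / s = c^-1 * c^-1 by rewrite -invfM c2 invf_div.
  rewrite -c2 -[dot a b in RHS]scale1r -[dot b a in RHS]scale1r.
  rewrite -[1](rmorph1 (real_complex R)) -(mulfV (lt0r_neq0 c0)) !dotE; lmod_eq.
rewrite mulmxDl -/a -/b !dotE !scalerBr !scalerA -!rmorphM.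
have -> : (1 + s / r) * r ^+ 2 = r ^+ 2 + r * s by field.
have -> : (1 + r / s) * s ^+ 2 = s ^+ 2 + r * s by field.
rewrite (_ : (r + s) ^+ 2 = r ^+ 2 + r * s + (s ^+ 2 + r * s)); last by ring.
by move: (s / r) (r / s) => al be; lmod_eq.
Qed.

Lemma opbound_delta x i j : opbound (x *: delta_mx i j) (nrm x).
Proof.
split=> [|v]; first exact: nrm_ge0.
have xv k : ((x *: delta_mx i j) *m v) k 0 = (k == i)%:R * (x * v j 0).
  rewrite mxE (bigD1 j) //= big1 ?addr0 => [|l /negPf lj].
    by rewrite !mxE eqxx andbT; case: (k == i); rewrite ?mulr1 ?mul1r ?mulr0 ?mul0r.
  by rewrite !mxE lj andbF mulr0 mul0r.
have -> : dot ((x *: delta_mx i j) *m v) ((x *: delta_mx i j) *m v) =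
    cstar (v j 0) * (cstar x * x) * v j 0.
  rewrite /dot (bigD1 i) //= big1 ?addr0 => [|k /negPf ki].
    by rewrite xv eqxx mul1r csM !mulrA.
  by rewrite xv ki mul0r mulr0.
rewrite /dot (bigD1 j) //= scalerDr addrAC; apply: psdD; last first.
  by apply: psdZ; [exact: sqr_ge0|apply: psd_sum => k _; exact: psd_csM].
have -> : (nrm x ^+ 2)%:C *: (cstar (v j 0) * v j 0) - cstar (v j 0) * (cstar x * x) * v j 0 =
   cstar (v j 0) * ((nrm x ^+ 2)%:C *: (1 : T) - cstar x * x) * v j 0.
  by rewrite mulrBr mulrBl scmulAr mulr1 scmulAl.
by apply/psd_conj/psd_ub; rewrite ?csM ?cstarK // nrm_sqr.
Qed.

Lemma opbound_of_entries X e : (forall i j, nrm (X i j) <= e) ->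
  opbound X (n%:R * n%:R * e).
Proof.
move=> he.
have sumb (F : 'I_n -> 'M[T]_n) (d : R) :
    (forall i, opbound (F i) d) -> opbound (\sum_i F i) (n%:R * d).
  move=> hF; rewrite mulr_natl -[n in d *+ n]card_ord -sumr_const.
  by elim/big_ind2: _ => [|Z a W b|i _]; [exact: opbound0|exact: opboundD|exact: hF].
rewrite (matrix_sum_delta X) -mulrA; apply: (sumb) => i; apply: sumb => j.
exact: opbound_le (opbound_delta _ _ _) (he i j).
Qed.

Lemma opbound_ex X : exists2 s, 0 < s & opbound X s.
Proof.
pose e := \sum_i \sum_j nrm (X i j).
have he i j : nrm (X i j) <= e.
  rewrite /e (bigD1 i) //= (bigD1 j) //= -addrA lerDl addr_ge0 //.
    by apply: sumr_ge0 => k _; exact: nrm_ge0.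
  by apply: sumr_ge0 => k _; apply: sumr_ge0 => l _; exact: nrm_ge0.
have h := opbound_of_entries he; have [h0 _] := h.
by exists (n%:R * n%:R * e + 1); [lra|apply: opbound_le h _; lra].
Qed.

(** Entrywise limits only come with the crude factor [n^2]. The sharp rate is recovered by passing
    through a later term [u l], where the crude bound on [Y - u l] is already below [e]. *)
Lemma opbound_complete (u : nat -> 'M[T]_n) (d : nat -> R) :
  (forall k l, (k <= l)%N -> opbound (u l - u k) (d k)) ->
  (forall k e, 0 < e -> exists2 l, (k <= l)%N & d l < e) ->
  exists Y, forall k e, 0 < e -> opbound (Y - u k) (d k + e).
Proof.
move=> hu hd.
have hy i j : exists y, forall k e, 0 < e -> nrm (y - u k i j) <= d k + e.
  apply: nrm_complete hd => k l kl.
  by have := opbound_entry i j (hu _ _ kl); rewrite !mxE.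
pose Y := \matrix_(i, j) sval (cid (hy i j)).
exists Y => k e e0; pose m : R := n%:R * n%:R.
have m0 : 0 <= m by rewrite mulr_ge0.
pose del := e / (2 * (m + 1)).
have del0 : 0 < del by rewrite divr_gt0 //; lra.
have [l kl dl] := hd k _ del0.
have h1 : opbound (Y - u l) (m * (d l + del)).
  by apply: opbound_of_entries => i j; rewrite !mxE; case: cid => y /= /(_ l _ del0).
have -> : Y - u k = (u l - u k) + (Y - u l) by zmod_eq.
apply: opbound_le (opboundD (hu _ _ kl) h1) _; rewrite lerD2l.
have : del * (2 * (m + 1)) = e by rewrite /del divfK // gt_eqF //; lra.
nra.
Qed.

(** Follows from [1 - Z^2 = (1 - Z) + Z (1 - Z) Z + (1 - Z) Z (1 - Z)], each summand being
    positive. *)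
Lemma opbound_le1 Z : mxstar cstar Z = Z -> mxpsd Z -> mxpsd (1%:M - Z) -> opbound Z 1.
Proof.
move=> sZ Z0 Z1; split=> // v.
set w := Z *m v; pose x := Z *m w.
have adj a b : dot (Z *m a) b = dot a (Z *m b) by rewrite dot_mulmxl sZ.
have h1 := Z1 v; have h2 := Z1 w; have h3 := Z0 (v - w).
have := psdD h1 (psdD h2 h3).
rewrite mulmxBr !mulmxBl !mul1mx -/w -/x expr1n scale1r; congr psd.
have e1 : dot v x = dot w w by rewrite /x -adj.
by rewrite !dotE e1; zmod_eq.
Qed.

(** Follows from [2 s (s - X) = (s - X)^2 + (s^2 - X^2)]. *)
Lemma mxpsd_bound X s : mxstar cstar X = X -> 0 < s -> opbound X s ->
  mxpsd (rscale s 1%:M - X).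
Proof.
move=> sX s0 [_ hX] v; have := psdD (psd_dot (rscale s v - X *m v)) (hX v).
have e1 : dot (X *m v) v = dot v (X *m v) by rewrite dot_mulmxl sX.
move/(@psdZ _ _ (2 * s)^-1); rewrite invr_ge0 mulr_ge0 ?(ltW s0) // => /(_ isT).
congr psd; rewrite mulmxBl rscale_mull mul1mx !dotE e1.
have e2 : (2 * s)^-1 * (2 * s) = 1 by rewrite mulVf // mulf_neq0 // gt_eqF.
have eZ z : z = ((2 * s)^-1)%:C *: ((2 * s)%:C *: z) :> T.
  by rewrite scalerA -rmorphM /= e2 scale1r.
rewrite [RHS]eZ.
by congr (_ *: _); lmod_eq.
Qed.

Lemma psd_sqrt_mx X : mxstar cstar X = X -> mxpsd X -> cpos X.
Proof.
move=> sX hX; have [s s0 hs] := opbound_ex X.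
pose Z := 1%:M - rscale s^-1 X.
have sZ : mxstar cstar Z = Z.
  by rewrite mxstarD mxstarN mxstar1 mxstar_rscale sX.
have nZ : opbound Z 1.
  apply: opbound_le1 => // v.
    have /(@psdZ _ _ s^-1) := mxpsd_bound sX s0 hs v.
    rewrite invr_ge0 (ltW s0) => /(_ isT); congr psd.
    rewrite !mulmxBl !rscale_mull mul1mx !dotE scalerBr scalerA -rmorphM /=.
    by rewrite mulVf ?gt_eqF // scale1r.
  rewrite opprB addrC subrK rscale_mull dotZr; apply: psdZ (hX v).
  by rewrite invr_ge0 ltW.
pose half (X : 'M[T]_n) := rscale 2^-1 X.
have [|||||||||||y [hy ny hC]] := @sqrt_iteration R 'M[T]_n half opbound Z.
- by move=> A B; apply/matrixP => i j; rewrite !mxE scalerBr.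
- by move=> A; apply/matrixP => i j; rewrite !mxE half_double.
- exact: opbound0.
- exact: opboundN.
- exact: opboundD.
- exact: opboundM.
- by move=> A r hA; rewrite mulrC; apply: opbound_rscale => //; rewrite invr_ge0.
- exact: opbound_le.
- exact: opbound_eq0.
- exact: opbound_complete.
- exact: nZ.
have sy : mxstar cstar y = y.
  apply/matrixP => i j; rewrite mxstarE.
  apply/eqP; rewrite -subr_eq0; apply/eqP; apply: (@nrm_small_eq0 _ _ _ 2) => e e0.
  have [v sv hv] : exists2 v, mxstar cstar v = v & opbound (y - v) e.
    apply: hC => //; first exact: mxstar0.
    by move=> v sv; rewrite /half mxstar_rscale mxstarD mxstarM sv sZ.
  have h1 := opbound_entry i j hv; have h2 := opbound_entry j i hv.
  have -> : cstar (y j i) - y i j = cstar ((y - v) j i) - (y - v) i j.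
    by rewrite !mxE csD csN -(mxstarE v) sv; zmod_eq.
  by apply: le_trans (nrmD _ _) _; rewrite nrmN nrm_cs; lra.
pose q := Num.sqrt s.
exists (rscale q (1%:M - y)).
rewrite mxstar_rscale mxstarD mxstarN mxstar1 sy rscale_mull rscale_mulr rscaleA.
rewrite [_ *m _]hy /Z opprB addrC subrK rscaleA -expr2 sqr_sqrtr ?(ltW s0) //.
by rewrite mulfV ?gt_eqF // rscale1.
Qed.

(** The quadratic form vanishes, and polarizing with [v + w] and [v + i w] kills the sesquilinear
    form, whose values at basis vectors are the entries. *)
Lemma mxpsd_anti X : mxpsd X -> mxpsd (- X) -> X = 0.
Proof.
move=> h1 h2.
have q0 v : dot v (X *m v) = 0.
  by apply: psd_anti (h1 v) _; have := h2 v; rewrite mulNmx dotNr.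
pose I (v : 'cV[T]_n) : 'cV[T]_n := map_mx ( *:%R 'i%C) v.
have XI v : X *m I v = I (X *m v).
  apply/matrixP => i j; rewrite !mxE scaler_sumr; apply: eq_bigr => k _.
  by rewrite mxE scmulAr.
have dIr v w : dot v (I w) = 'i%C *: dot v w.
  by rewrite scaler_sumr; apply: eq_bigr => i _; rewrite mxE scmulAr.
have dIl v w : dot (I v) w = - ('i%C *: dot v w).
  by rewrite scaler_sumr -sumrN; apply: eq_bigr => i _; rewrite mxE csi mulNr scmulAl.
have pol v w : dot v (X *m w) + dot w (X *m v) = 0.
  have := q0 (v + w); rewrite mulmxDr !dotE !q0 add0r addr0 => <-.
  by rewrite addrC.
have d0 v w : dot v (X *m w) = 0.
  have := pol v (I w); rewrite XI dIr dIl -scalerN -scalerDr => /eqP.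
  rewrite scaler_eq0 eq_complex /= oner_eq0 andbF orFb => /eqP h3.
  have := half_double (dot v (X *m w)); rewrite -scalerDr => <-.
  rewrite (_ : _ + _ = (dot v (X *m w) + dot w (X *m v)) +
     (dot v (X *m w) - dot w (X *m v))); last by zmod_eq.
  by rewrite pol h3 addr0 scaler0.
by apply/matrixP => i j; rewrite mxE -mul_dvec -dot_dvec d0.
Qed.

End Dot.

(** * Matrix states detect the elements [Y^* Y] *)

Section MatrixStates.
Variable n : nat.
Implicit Types (X Y : 'M[T]_n) (f : 'M[T]_n -> R[i]).

Lemma mxstateD f X Y : mxstate f -> f (X + Y) = f X + f Y.
Proof.
case=> h _ _; rewrite -[X in LHS](_ : map_mx ( *:%R 1) X = X) ?h ?mul1r //.
by apply/matrixP => i j; rewrite mxE scale1r.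
Qed.

Lemma mxstate0 f : mxstate f -> f 0 = 0.
Proof. by move=> h; apply: (addrI (f 0)); rewrite -(mxstateD _ _ h) !addr0. Qed.

Lemma mxstateZ f a X : mxstate f -> f (map_mx ( *:%R a) X) = a * f X.
Proof. by move=> h; have [hl _ _] := h; rewrite -[map_mx _ _]addr0 hl (mxstate0 h) addr0. Qed.

Lemma mxstateN f X : mxstate f -> f (- X) = - f X.
Proof.
by move=> h; apply: (addrI (f X)); rewrite -mxstateD // !subrr mxstate0.
Qed.

Lemma cpos_shift X : mxstar cstar X = X -> exists2 s, 0 < s & cpos (rscale s 1%:M + X).
Proof.
move=> sX; have [s s0 hs] := opbound_ex (- X).
exists s => //; apply: psd_sqrt_mx.
  by rewrite mxstarD mxstar_rscale mxstar1 sX.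
by have := mxpsd_bound _ s0 hs; rewrite mxstarN sX opprK; exact.
Qed.

Lemma mxstate_real f X : mxstate f -> mxstar cstar X = X -> complex.Im (f X) = 0.
Proof.
move=> hf sX; have [s s0 /(let: And3 _ h _ := hf in h _)] := cpos_shift sX.
rewrite mxstateD // mxstateZ //; have [_ _ ->] := hf; rewrite mulr1.
by move/ger0_Im; rewrite raddfD /= add0r.
Qed.

(** A state [phi] of [T] that is not nonnegative at [dot v (X v)] yields the matrix state
    [Y |-> phi (dot v (Y v))], normalized by its value at the unit. *)
Lemma mxstate_mxpsd X : mxstar cstar X = X ->
  (forall f : 'M[T]_n -> R[i], mxstate f -> 0 <= complex.Re (f X)) -> mxpsd X.
Proof.
move=> sX hX v; apply: contrapT => hN.
have sv : cstar (dot v (X *m v)) = dot v (X *m v).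
  by rewrite dot_cs dot_mulmxl sX.
have [phi hphi phiN] := exists_state_not_ge0 sv hN; apply: phiN.
have [hl hp h1] := hphi.
pose c := phi (dot v v); have c0 : 0 <= c by apply: hp; exact: psd_dot.
pose g Y := phi (dot v (Y *m v)).
have gl (a : R[i]) Y Y' : g (map_mx ( *:%R a) Y + Y') = a * g Y + g Y'.
  rewrite /g mulmxDl dotDr -hl; congr (phi (_ + _)).
  rewrite scaler_sumr; apply: eq_bigr => i _; rewrite -scmulAr; congr (_ * _).
  by rewrite !mxE scaler_sumr; apply: eq_bigr => k _; rewrite mxE scmulAl.
have gp Y : cpos Y -> 0 <= g Y by case=> Z ->; apply/hp/mxpsd_csM.
have g1 : g 1%:M = c by rewrite /g mul1mx.
(* If [phi] kills [dot v v], normalization is impossible; but then [s + X], positive for large [s],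
   has the same value as [X], which is therefore nonnegative. *)
have [c00|cN] := eqVneq c 0.
  have [s s0 /gp] := cpos_shift sX.
  by rewrite gl g1 c00 mulr0 add0r.
have hf : mxstate (fun Y => c^-1 * g Y).
  split=> [a Y Y'|Y /gp|]; first by rewrite gl mulrDr mulrCA.
    by move=> ?; rewrite mulr_ge0 // invr_ge0.
  by rewrite g1 mulVf.
have fX : 0 <= c^-1 * g X.
  by rewrite lecE (mxstate_real hf sX) eqxx; exact: (hX _ hf).
by have := mulr_ge0 c0 fX; rewrite mulrA mulfV // mul1r.
Qed.

(** The order of [R[i]] includes being real, so every state vanishes on the self-adjoint matrix
    [i (X - X^* )]. This matrix is then 0 by [mxpsd_anti], which gives the self-adjointness that
    [psd_sqrt_mx] requires. *)
Lemma cpos_mxstate X : (forall f : 'M[T]_n -> R[i], mxstate f -> 0 <= f X) -> cpos X.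
Proof.
move=> hX.
pose I (Y : 'M[T]_n) : 'M[T]_n := map_mx ( *:%R 'i%C) Y.
pose B := I (X - mxstar cstar X).
have sB : mxstar cstar B = B.
  by apply/matrixP => i j; rewrite !mxE csi csD csN cstarK -scalerN opprB.
have fs f : mxstate f -> f (mxstar cstar X) = f X.
  move=> hf; have sA : mxstar cstar (X + mxstar cstar X) = X + mxstar cstar X.
    by rewrite mxstarD mxstarK addrC.
  have := mxstate_real hf sA; have := mxstate_real hf sB.
  rewrite mxstateZ // !mxstateD // mxstateN //; have := ger0_Im (hX f hf).
  case: (f X) => a b; case: (f _) => a' b' /= -> h1 h2.
  by apply/eqP; rewrite eq_complex /=; apply/andP; split; apply/eqP; lra.
have fB f : mxstate f -> f B = 0.
  by move=> hf; rewrite mxstateZ // mxstateD // mxstateN // fs // subrr mulr0.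
have B0 : B = 0.
  apply: mxpsd_anti; apply: mxstate_mxpsd; rewrite ?mxstarN ?sB // => f hf.
    by rewrite fB.
  by rewrite mxstateN // fB // oppr0.
have sX : mxstar cstar X = X.
  apply/matrixP => i j; move/matrixP/(_ i j)/eqP: B0; rewrite !mxE.
  rewrite scaler_eq0 eq_complex /= oner_eq0 andbF orFb subr_eq0.
  by move/eqP => ->.
apply: psd_sqrt_mx => //; apply: mxstate_mxpsd => // f /hX.
by rewrite lecE => /andP[].
Qed.

Lemma cposD X Y : cpos X -> cpos Y -> cpos (X + Y).
Proof.
move=> hX hY; apply: cpos_mxstate => f hf; rewrite mxstateD //.
by have [_ hp _] := hf; rewrite addr_ge0 // hp.
Qed.

End MatrixStates.
End MatrixPositivity.

(** * The real-valued modulus of a complex number *)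

Section ComplexModulus.
Variable R : realType.
Implicit Types (z w : R[i]) (r : R).

Definition cabs z : R := complex.Re `|z|.

Lemma cabsE z : `|z| = (cabs z)%:C.
Proof. by rewrite /cabs normc_def. Qed.

Lemma cabs_ge0 z : 0 <= cabs z.
Proof. by rewrite -ler0c -cabsE. Qed.

Lemma cabsD z w : cabs (z + w) <= cabs z + cabs w.
Proof. by rewrite -lecR rmorphD /= -!cabsE ler_normD. Qed.

Lemma cabsZ r z : 0 <= r -> cabs (r%:C * z) = r * cabs z.
Proof.
move=> r0; apply: complexI; rewrite rmorphM /= -!cabsE normrM; congr (_ * _).
by rewrite ger0_norm // ler0c.
Qed.

Lemma Re_le_cabs z : `|complex.Re z| <= cabs z.
Proof. by rewrite -lecR -cabsE normc_ge_Re. Qed.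

Lemma Im_le_cabs z : `|complex.Im z| <= cabs z.
Proof.
have := Re_le_cabs ('i%C * z); rewrite mulrC ReiNIm normrN; congr (_ <= _).
by apply: complexI; rewrite -!cabsE normrM [`|'i%C|]normc_def /= expr0n add0r expr1n sqrtr1 mulr1.
Qed.

Lemma ge0_of_approx z : (forall e, 0 < e -> exists2 w, 0 <= w & cabs (w - z) < e) -> 0 <= z.
Proof.
move=> hz; rewrite lecE /=; apply/andP; split.
  rewrite -normr_le0; apply/ler_addgt0Pr => e e0; rewrite add0r.
  have [w w0 wz] := hz e e0; apply: le_trans (ltW wz).
  by apply: le_trans (Im_le_cabs _); rewrite raddfB /= (ger0_Im w0) sub0r normrN.
apply/ler_addgt0Pr => e e0; have [w w0 wz] := hz e e0.
have := le_lt_trans (Re_le_cabs _) wz; rewrite raddfB /= => h.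
by move: w0; rewrite lecE /= => /andP[_]; move: (ler_norm (complex.Re w - complex.Re z)); lra.
Qed.

End ComplexModulus.

(** * Matrix tests, the topology [tau], and the two inclusions *)

Section Polar.
Variables (R : realType) (S : opSystemType R) (T : cstarAlgType R).
Implicit Types (Phi Psi : S -> T) (K A : set (S -> T)) (t : matrix_test S T) (r e : R).

Lemma cpos_scalar_conj n (a : T) (Y : 'M[T]_n) :
  cpos Y -> cpos (\matrix_(i, j) (cstar a * Y i j * a)).
Proof.
case=> Z ->; exists (\matrix_(i, j) (Z i j * a)).
apply/matrixP => i j; rewrite !mxE mulr_sumr mulr_suml; apply: eq_bigr => k _.
by rewrite !mxE csM !mulrA.
Qed.

Lemma cpos0 n : cpos (0 : 'M[T]_n).
Proof. by exists 0; rewrite mulmx0. Qed.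

Lemma CP_cstar_convex : cstar_convex (CP S T).
Proof.
move=> n Phi a hPhi _; split=> [c x y|k X hX].
  rewrite scaler_sumr -big_split; apply: eq_bigr => i _ /=.
  have [hl _] := hPhi i.
  by rewrite hl mulrDr mulrDl scmulAr scmulAl.
have -> : map_mx (fun s => \sum_i cstar (a i) * Phi i s * a i) X =
    \sum_i \matrix_(k, l) (cstar (a i) * (map_mx (Phi i) X) k l * a i).
  apply/matrixP => k' l; rewrite summxE mxE.
  by apply: eq_bigr => i _; rewrite !mxE.
elim/big_ind: _ => [|x y|i _]; [exact: cpos0|exact: cposD|].
by apply: cpos_scalar_conj; have [_ h] := hPhi i; exact: h.
Qed.

Lemma cconv_sub_CP K : K `<=` CP S T -> cconv K `<=` CP S T.
Proof.
by move=> hK; apply: smallest_sub => //; split=> //; exact: CP_cstar_convex.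
Qed.

Lemma cconv_cstar_convex K : cstar_convex (cconv K).
Proof.
move=> n Phi a hPhi ha A [[AC cA] KA]; apply: (cA) ha => i.
exact: (hPhi i A (conj (conj AC cA) KA)).
Qed.

(** Ordinary convex combinations are those with scalar coefficients [sqrt r] and [sqrt s];
    Mazur-Orlicz needs this convexity of the hull. *)
Lemma cstar_convex_segment A r s Phi Psi : cstar_convex A ->
  0 <= r -> 0 <= s -> r + s = 1 -> A Phi -> A Psi -> A (r%:C *: Phi + s%:C *: Psi).
Proof.
move=> cA r0 s0 rs hPhi hPsi.
have sq (q : R) (x : T) : 0 <= q ->
    cstar ((Num.sqrt q)%:C *: (1 : T)) * x * ((Num.sqrt q)%:C *: (1 : T)) = q%:C *: x :> T.
  move=> q0; rewrite csZr cs1 scmulAl mul1r scmulAr mulr1 scalerA -rmorphM /=.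
  by rewrite -expr2 sqr_sqrtr.
pose a (i : 'I_2) : T := (Num.sqrt (if i == ord0 then r else s))%:C *: (1 : T).
pose F (i : 'I_2) := if i == ord0 then Phi else Psi.
have := cA 1%N F a.
rewrite big_ord_recl big_ord1 /a /= -[X in X * _ + _]mulr1 -[X in _ + X * _]mulr1 !sq //.
rewrite -scalerDl -rmorphD rs scale1r.
have -> : (fun x => \sum_(i < 2) cstar (a i) * F i x * a i) = r%:C *: Phi + s%:C *: Psi.
  by apply/funext => x; rewrite big_ord_recl big_ord1 /a /F /= !sq.
by apply=> // i; rewrite /F; case: ifP.
Qed.

Lemma mt_evalD t Phi Psi : mt_eval t (Phi + Psi) = mt_eval t Phi + mt_eval t Psi.
Proof.
rewrite /mt_eval -(mxstateD _ _ (mt_funP t)); congr (mt_fun t _).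
by apply/matrixP => i j; rewrite !mxE.
Qed.

Lemma mt_evalZ t (a : R[i]) Phi : mt_eval t (a *: Phi) = a * mt_eval t Phi.
Proof.
rewrite /mt_eval -(mxstateZ _ _ (mt_funP t)); congr (mt_fun t _).
by apply/matrixP => i j; rewrite !mxE.
Qed.

Lemma mt_evalB t Phi Psi : mt_eval t (Phi - Psi) = mt_eval t Phi - mt_eval t Psi.
Proof. by rewrite -scaleN1r mt_evalD mt_evalZ mulN1r. Qed.

Lemma mt_eval0 t : mt_eval t (0 : S -> T) = 0.
Proof. by rewrite -(scale0r (0 : S -> T)) mt_evalZ mul0r. Qed.

Lemma cp_span_CP Phi : CP S T Phi -> Phi \in cp_span_pred (S := S) (T := T).
Proof.
move=> hPhi; apply/asboolP; exists 1%N, (fun=> 1), (fun=> Phi); split=> //.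
by rewrite big_ord1 scale1r.
Qed.

Lemma cp_span_linear Phi : Phi \in cp_span_pred (S := S) (T := T) -> linear Phi.
Proof.
move=> /asboolP[n [c [Psi [hPsi ->]]]] a x y.
rewrite !fct_sumE scaler_sumr -big_split; apply: eq_bigr => i _ /=.
have [hl _] := hPsi i.
rewrite -!/((c i *: Psi i) _) -[LHS]/(c i *: Psi i (a *: x + y)).
by rewrite hl scalerDr !scalerA mulrC -scalerA.
Qed.

Definition test_filter (z : cp_space S T) : set_system (cp_space S T) :=
  [set U | exists m (ts : 'I_m -> matrix_test S T) e, 0 < e /\
    forall w : cp_space S T, (forall i, tau_seminorm (ts i) (w - z) < e%:C) -> U w].

Lemma test_filterP z : Filter (test_filter z).
Proof.
split.
- have ts : 'I_0 -> matrix_test S T by case.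
  by exists 0%N, ts, 1.
- move=> U V [m [ts [e [e0 hU]]]] [m' [ts' [e' [e'0 hV]]]].
  exists (m + m')%N, (fun i => match fintype.split i with inl j => ts j | inr j => ts' j end).
  exists (Num.min e e'); split=> [|w hw]; first by rewrite lt_min e0.
  split; [apply: hU|apply: hV] => i.
    have := hw (unsplit (inl i)); rewrite unsplitK => /lt_le_trans; apply.
    by rewrite lecR ge_min lexx.
  have := hw (unsplit (inr i)); rewrite unsplitK => /lt_le_trans; apply.
  by rewrite lecR ge_min lexx orbT.
- move=> U V UV [m [ts [e [e0 hU]]]]; exists m, ts, e; split=> // w hw.
  by apply: UV; exact: hU.
Qed.

(** A subbasic ball need not be centred at [z]; it is recentred with radius [e - d], where [d] is
    the seminorm distance from [z] to its centre. *)
Lemma nbhs_test_filter (z : cp_space S T) U : nbhs z U -> test_filter z U.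
Proof.
rewrite nbhsE => -[_ [[D sD <-] [C DC Cz]] sUC].
have FF := test_filterP z.
apply: (filterS sUC); apply: (@filterS _ _ _ C) => [w Cw|]; first by exists C.
have /sD [E sE IEC] := DC; rewrite -IEC; apply: filter_bigI => V EV.
have /sE := EV; rewrite inE => -[t [w0 [e [e0 VE]]]].
have Vz : V z by move: Cz; rewrite -IEC => /(_ _ EV).
move: Vz; rewrite VE /= => hz.
have [d dE] : exists d, tau_seminorm t (z - w0) = d%:C.
  by exists (cabs (mt_eval t (val (z - w0)))); exact: cabsE.
move: hz; rewrite dE ltcR => hz.
exists 1%N, (fun=> t), (e - d); split=> [|w /(_ ord0) hw]; first by rewrite subr_gt0.
suff : tau_seminorm t (w - w0) < e%:C by [].
rewrite {1}/tau_seminorm.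
have -> : val (w - w0) = val (w - z) + val (z - w0) :> (S -> T).
  by rewrite -raddfD /= addrA subrK.
rewrite mt_evalD; apply: le_lt_trans (ler_normD _ _) _.
rewrite -/(tau_seminorm t (w - z)) -/(tau_seminorm t (z - w0)) dE.
by rewrite -(subrK d e) rmorphD /= ltrD2r.
Qed.

Lemma tau_closure_approx A Phi t e : tau_closure A Phi -> 0 < e ->
  exists2 Psi, A Psi & cabs (mt_eval t Psi - mt_eval t Phi) < e.
Proof.
move=> [z clz <-] e0.
pose U := [set w : cp_space S T | tau_seminorm t (w - z) < e%:C].
have /clz [w [/= Aw Uw]] : nbhs z U.
  rewrite nbhsE; exists U => //; split; last first.
    by rewrite /U /tau_seminorm /= subrr mt_eval0 normr0 ltcR.
  exists [set U]; last by rewrite bigcup_set1.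
  move=> _ ->; exists (finmap.fset1 U).
    by move=> V; rewrite finmap.in_fset1 => /eqP ->; apply/mem_set; exists t, z, e.
  by rewrite set_fset1 bigcap_set1.
exists (val w) => //; rewrite -mt_evalB -ltcR -cabsE.
exact: Uw.
Qed.

Lemma tau_closure_CP A : A `<=` CP S T -> tau_closure A `<=` CP S T.
Proof.
move=> AC Phi hPhi; split.
  by case: hPhi => z _ <-; apply: cp_span_linear; exact: valP.
(* Matrix tests have positive size, so the empty matrix is settled by hand. *)
move=> [|n] X hX.
  by exists 0; apply/matrixP => -[].
apply: cpos_mxstate => f hf; apply: ge0_of_approx => e e0.
have [Psi APsi hPsi] := tau_closure_approx (MatrixTest X (ltn0Sn n) hf) hPhi e0.
exists (f (map_mx Psi X)) => //.
by have [_ hp _] := hf; apply: hp; have [_] := AC _ APsi; exact.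
Qed.

(** A diagonal corner of [Y^* Y] factors through a rectangular matrix only. Its positivity is
    instead tested on vectors padded with zeros, and [psd_sqrt_mx] supplies a square factor. *)
Lemma cpos_ulsubmx n m (X : 'M[T]_(n + m)) : cpos X -> cpos (ulsubmx X) /\ cpos (drsubmx X).
Proof.
case=> Y ->; set X' := _ *m Y.
have sX : mxstar cstar X' = X' by rewrite mxstarM mxstarK.
have hX : mxpsd X' by exact: mxpsd_csM.
move: X' sX hX => {Y}Y sX hX.
have dot_col (a c : 'cV[T]_n) (b d : 'cV[T]_m) :
    dot (col_mx a b) (col_mx c d) = dot a c + dot b d.
  rewrite /dot big_split_ord; congr (_ + _); apply: eq_bigr => i _ /=.
    by rewrite !col_mxEu.
  by rewrite !col_mxEd.
have dot0l k (v : 'cV[T]_k) : dot 0 v = 0.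
  by rewrite /dot big1 // => i _; rewrite mxE cs0 mul0r.
split; apply: psd_sqrt_mx.
- apply/matrixP => i j; rewrite mxstarE !mxE.
  by move/matrixP/(_ (lshift m i) (lshift m j)): sX; rewrite mxstarE.
- move=> v; have := hX (col_mx v 0); rewrite -[Y in X in psd X]submxK.
  by rewrite mul_block_col !mulmx0 !addr0 dot_col dot0l addr0.
- apply/matrixP => i j; rewrite mxstarE !mxE.
  by move/matrixP/(_ (rshift n i) (rshift n j)): sX; rewrite mxstarE.
- move=> v; have := hX (col_mx 0 v); rewrite -[Y in X in psd X]submxK.
  by rewrite mul_block_col !mulmx0 !add0r dot_col dot0l add0r.
Qed.

Lemma test_scale t (a : R[i]) : exists t', forall Psi, linear Psi ->
  mt_eval t' Psi = a * mt_eval t Psi.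
Proof.
exists (MatrixTest (map_mx ( *:%R a) (mt_mx t)) (mt_size_gt0 t) (mt_funP t)).
move=> Psi hPsi; rewrite /mt_eval /= -(mxstateZ _ _ (mt_funP t)).
congr (mt_fun t _); apply/matrixP => i j; rewrite !mxE.
have Psi0 : Psi 0 = 0.
  by apply: (addrI (Psi 0)); have := hPsi 1 0 0; rewrite !scale1r !addr0 => <-.
by have := hPsi a (mt_mx t i j) 0; rewrite Psi0 !addr0.
Qed.

Lemma test_average t1 t2 : exists t, forall Psi,
  mt_eval t Psi = 2^-1 * (mt_eval t1 Psi + mt_eval t2 Psi).
Proof.
case: t1 t2 => [k1 f1 s1 k1_gt0 hf1] [k2 f2 s2 k2_gt0 hf2].
pose f (X : 'M[T]_(k1 + k2)) := 2^-1 * (f1 (ulsubmx X) + f2 (drsubmx X)).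
have hf : mxstate f.
  have [l1 p1 e1] := hf1; have [l2 p2 e2] := hf2; split=> [a X Y|X /cpos_ulsubmx[u d]|].
  - rewrite /f.
    have -> : ulsubmx (map_mx ( *:%R a) X + Y) = map_mx ( *:%R a) (ulsubmx X) + ulsubmx Y.
      by apply/matrixP => i j; rewrite !mxE.
    have -> : drsubmx (map_mx ( *:%R a) X + Y) = map_mx ( *:%R a) (drsubmx X) + drsubmx Y.
      by apply/matrixP => i j; rewrite !mxE.
    by rewrite l1 l2; ring.
  - by rewrite /f mulr_ge0 ?invr_ge0 ?ler0n // addr_ge0 ?p1 ?p2.
  - rewrite /f scalar_mx_block block_mxKul block_mxKdr e1 e2.
    by rewrite mulVf // pnatr_eq0.
have k0 : (0 < k1 + k2)%N by rewrite addn_gt0 k1_gt0.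
exists (MatrixTest (block_mx s1 0 0 s2) k0 hf) => Psi.
by rewrite /mt_eval /= /f map_block_mx block_mxKul block_mxKdr.
Qed.

(* Every continuous functional on the span is, up to a positive factor and on
   linear maps, evaluation at a single matrix test. *)
Lemma test_combination m (ts : 'I_m.+1 -> matrix_test S T) (w : 'I_m.+1 -> R[i]) :
  exists t c, 0 < c /\ forall Psi, linear Psi ->
    mt_eval t Psi = c%:C * \sum_i w i * mt_eval (ts i) Psi.
Proof.
elim: m ts w => [|m IH] ts w.
  have [t ht] := test_scale (ts ord0) (w ord0); exists t, 1; split=> // Psi hPsi.
  by rewrite big_ord1 mul1r ht.
have [t1 [c [c0 h1]]] := IH (ts \o lift ord0) (w \o lift ord0).
(* The extra factor [c] matches the one already carried by [t1], so that averaging leaves the common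
   factor [c / 2]. *)
have [t2 h2] := test_scale (ts ord0) (c%:C * w ord0).
have [t ht] := test_average t1 t2.
exists t, (2^-1 * c); split=> [|Psi hPsi]; first by rewrite mulr_gt0 // invr_gt0.
rewrite ht h1 // h2 // [in RHS]big_ord_recl rmorphM /= fmorphV rmorph_nat /=.
by rewrite addrC -!mulrA -mulrDr.
Qed.

Lemma real_linear_row m (g : 'rV[R[i]]_m -> R) : real_linear g ->
  exists w : 'I_m -> R[i], forall x, g x = complex.Re (\sum_i w i * x 0 i).
Proof.
move=> hg; exists (fun i => g (delta_mx 0 i) -i* g ('i%C *: delta_mx 0 i)) => x.
have g0 : g 0 = 0 by have := hg.2 0 0; rewrite scaler0 mul0r.
have gsum (I : Type) (s : seq I) (F : I -> 'rV[R[i]]_m) :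
    g (\sum_(i <- s) F i) = \sum_(i <- s) g (F i).
  by apply: (big_morph g) => //; exact: hg.1.
rewrite {1}(row_sum_delta x) gsum raddf_sum; apply: eq_bigr => i _ /=.
rewrite {1}(complexE (x 0 i)) scalerDl hg.1 hg.2 mulrC -['i%C * _]mulrC -scalerA hg.2.
by case: (x 0 i) => a b /=; ring.
Qed.

(** A neighbourhood of [Phi] missing the hull produces a test in [polar K] whose real part at [Phi]
    exceeds 1. *)
Lemma cstar_polar_closure K Phi : K `<=` CP S T -> tau_closure (cconv K) (0 : S -> T) ->
  cstar_polar (polar K) Phi -> tau_closure (cconv K) Phi.
Proof.
move=> hK h0 [hPhi hpol].
pose z : cp_space S T := exist _ Phi (cp_span_CP hPhi).
exists z => // U /nbhs_test_filter[m [ts [e [e0 hU]]]].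
apply: contrapT => hN.
have lin Psi : cconv K Psi -> linear Psi by move=> /(cconv_sub_CP hK)[].
have far Psi : cconv K Psi ->
    exists i, e <= cabs (mt_eval (ts i) Phi - mt_eval (ts i) Psi).
  move=> hPsi; apply: contrapT => H; apply: hN.
  pose w : cp_space S T := exist _ Psi (cp_span_CP (cconv_sub_CP hK hPsi)).
  exists w; split => //; apply: hU => i.
  rewrite /tau_seminorm cabsE ltcR ltNge; apply/negP => le; apply: H; exists i.
  apply: le_trans le _; rewrite le_eqVlt; apply/orP; left; apply/eqP.
  apply: complexI; rewrite -!cabsE /= mt_evalB distrC; congr (`|_ - _|).
have [Psi0 hPsi0] : exists Psi, cconv K Psi.
  have [z0 clz0 _] := h0; have [w [hw _]] := clz0 _ filterT.
  by exists (val w).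
case: m ts hU far => [|m] ts hU far; first by have [[]] := far _ hPsi0.
pose L Psi : 'rV[R[i]]_m.+1 := \row_i mt_eval (ts i) Psi.
(* The sum of moduli is sublinear and at least [e] on [D], since by [far] each difference has one
   coordinate of modulus at least [e]. *)
pose p (x : 'rV[R[i]]_m.+1) := \sum_i cabs (x 0 i).
have hp : sublinear p.
  split=> [x y|r x r0].
    by rewrite -big_split; apply: ler_sum => i _; rewrite mxE cabsD.
  by rewrite mulr_sumr; apply: eq_bigr => i _; rewrite mxE cabsZ.
pose D := [set x | exists2 Psi, cconv K Psi & x = L Phi - L Psi].
have [||d [Psi hPsi ->]|g [hg gp gD]] := @mazur_orlicz _ _ p D e hp.
- by exists (L Phi - L Psi0); exists Psi0.
- move=> r s _ _ r0 s0 rs [Psi hPsi ->] [Psi' hPsi' ->].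
  exists (r%:C *: Psi + s%:C *: Psi').
    exact: (cstar_convex_segment (@cconv_cstar_convex K) r0 s0 rs hPsi hPsi').
  apply/rowP => i; rewrite !mxE mt_evalD !mt_evalZ.
  have -> : s = 1 - r by lra.
  by rewrite rmorphB rmorph1 /=; ring.
- have [i hi] := far _ hPsi; apply: le_trans hi _.
  rewrite /p (bigD1 i) //= !mxE lerDl; apply: sumr_ge0 => j _; exact: cabs_ge0.
have [w gw] := real_linear_row hg.
have [t [c [c0 ht]]] := test_combination ts w.
have sep Psi : cconv K Psi ->
    c * e + complex.Re (mt_eval t Psi) <= complex.Re (mt_eval t Phi).
  move=> hPsi; have /gD : D (L Phi - L Psi) by exists Psi.
  rewrite gw.
  rewrite -(ler_pM2l c0) => /le_trans h.
  rewrite -lerBrDr -raddfB /= (ht _ hPhi.1) (ht _ (lin _ hPsi)).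
  apply: h; rewrite -mulrBr -sumrB.
  rewrite (_ : \sum_i (_ - _) = \sum_i w i * (L Phi - L Psi) 0 i); last first.
    by apply: eq_bigr => i _; rewrite !mxE mulrBr.
  by case: (\sum_i _) => a b /=; rewrite mul0r subr0.
set a := complex.Re (mt_eval t Phi) in sep.
have ce : 0 < c * e by rewrite mulr_gt0.
(* Elements of the hull on which [t] is arbitrarily small exist because 0 lies in the closure; [sep]
   at such elements gives the bound. *)
have ae : c * e <= a.
  apply/ler_addgt0Pr => d d0; have [Psi hPsi] := tau_closure_approx t h0 d0.
  rewrite mt_eval0 subr0 => hd; have := sep _ hPsi.
  have := Re_le_cabs (mt_eval t Psi); rewrite ler_norml => /andP[]; lra.
(* On the hull the real part of [t] is at most [a - c e], and at [Phi] it is [a]; the threshold [b]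
   lies strictly between, and dividing by it moves it to 1. *)
pose b := a - c * e / 2; have b0 : 0 < b by rewrite /b; lra.
have [t' ht'] := test_scale t (b^-1)%:C.
have ReZ z' : complex.Re ((b^-1)%:C * z') = b^-1 * complex.Re z'.
  by case: z' => x y /=; rewrite mul0r subr0.
have : complex.Re (mt_eval t' Phi) <= 1.
  apply: hpol => Psi hPsi; rewrite (ht' _ (lin _ hPsi)) ReZ ler_pdivrMl // mulr1.
  by have := sep _ hPsi; rewrite /b; lra.
rewrite (ht' _ hPhi.1).
by rewrite ReZ ler_pdivrMl // mulr1 -/a /b; lra.
Qed.

Lemma closure_cstar_polar K Phi : K `<=` CP S T -> tau_closure (cconv K) Phi ->
  cstar_polar (polar K) Phi.
Proof.
move=> hK hPhi; split; first exact: tau_closure_CP (cconv_sub_CP hK) _ hPhi.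
move=> t ht; apply/ler_addgt0Pr => e e0.
have [Psi hPsi h] := tau_closure_approx t hPhi e0.
have := le_lt_trans (Re_le_cabs _) h; rewrite raddfB /= distrC.
have := ht _ hPsi; move: (ler_norm (complex.Re (mt_eval t Phi) - complex.Re (mt_eval t Psi))).
by lra.
Qed.

End Polar.

Theorem corollary4p6 (R : realType) (S : opSystemType R) (T : cstarAlgType R)
    (K : set (S -> T)) (hK : K `<=` CP S T)
    (h0 : tau_closure (cconv K) (0 : S -> T)) :
  cstar_polar (polar K) = tau_closure (cconv K).
Proof.
apply/seteqP; split=> Phi; first exact: cstar_polar_closure.
exact: closure_cstar_polar.
Qed.
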